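(* Let $P_n$ be the path graph on $n$ vertices. Let $X$ be the number of crossings in a uniformly random embedding of $P_n$, and let $W=\frac{X-E(X)}{\sqrt{\mathrm{Var}(X)}}$. Then $$\mathrm{Var}(X)=\frac{n^3}{45}-\frac{n^2}{18}-\frac{11n}{45}+\frac23,$$ and $$d_K(W,Z)\le\frac{6270}{\sqrt{n-1}}\qquad\text{for all } n\ge 2,$$ where $Z$ is a standard normal random variable.
   Context: Let $G=(V,E)$ be a graph with vertex set $V=[n]=\{1,\dots,n\}$. For a permutation $\pi\in S_n$, the embedding $G_\pi$ is the graph on $[n]$ in which $(\pi(v),\pi(w))$ is an edge if and only if $(v,w)\in E$. A crossing in $G_\pi$ is a quadruple $(a,b,c,d)$ of vertices with $(a,b),(c,d)\in E$ and $\pi(a)>\pi(c)>\pi(b)>\pi(d)$. A uniformly random embedding of $G$ is $G_\pi$ with $\pi$ uniformly random in $S_n$. The Kolmogorov distance between real random variables is $d_K(X,Y)=\sup_{x\in\mathbb{R}}|P(X\le x)-P(Y\le x)|$.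
   Formalization: The variance formula is asserted only for n ≥ 4 (for n ≤ 3 there are no crossings, so Var(X)=0, while the formula gives e.g. 2/15 at n=2 and 1/30 at n=3); for n = 2, 3, where W is 0/0, W is taken to be 0 in the distance bound. *)

(* Defs.v *)
From HB Require Import structures.
From mathcomp Require Import all_boot all_order all_fingroup all_algebra.
From mathcomp Require Import all_classical all_reals all_analysis.
From mathcomp Require Import measurable_realfun.

Set Implicit Arguments.
Unset Strict Implicit.
Unset Printing Implicit Defensive.

Import Order.TTheory GRing.Theory Num.Theory.
Import numFieldNormedType.Exports.

Local Open Scope classical_set_scope.
Local Open Scope ring_scope.

(* Vertices are numbered 0, ..., n - 1 rather than 1, ..., n. *)
Definition path_graph (n : nat) : rel 'I_n :=
  fun i j => (i.+1 == j :> nat) || (j.+1 == i :> nat).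
Arguments path_graph n : clear implicits.

(* For a symmetric e, a pair of crossing edges contributes exactly one
   quadruple: s a > s b and s c > s d orient both edges, and s a > s c orders
   them. *)
Definition crossing (n : nat) (e : rel 'I_n) (s : 'S_n)
    (q : 'I_n * 'I_n * 'I_n * 'I_n) : bool :=
  let: (a, b, c, d) := q in
  [&& e a b, e c d, (s a > s c)%N, (s c > s b)%N & (s b > s d)%N].

Definition crossing_number (n : nat) (e : rel 'I_n) (s : 'S_n) : nat :=
  #|[set q | crossing e s q]%SET|.

(* The instances are keyed on perm_type, to which 'S_n unfolds. *)
HB.instance Definition _ (V : finType) := isPointed.Build (perm_type V) 1%g.
HB.instance Definition _ (V : finType) := @isMeasurable.Build
  default_measure_display (perm_type V) discrete_measurable
  discrete_measurable0 discrete_measurableC discrete_measurableU.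

Definition uniform_permutation d (T : measurableType d) (R : realType)
    (P : probability T R) (n : nat) (pi : {RV P >-> 'S_n}) : Prop :=
  forall s : 'S_n, distribution P pi [set s] = ((n`!)%:R^-1)%:E.

Section crossings.
Context d (T : measurableType d) (R : realType) (P : probability T R).
Variables (n : nat) (e : rel 'I_n).

Definition crossing_number_real (s : 'S_n) : R := (crossing_number e s)%:R.

Let measurable_crossing_number_real :
  measurable_fun [set: 'S_n] crossing_number_real.
Proof. by []. Qed.

HB.instance Definition _ := isMeasurableFun.Build _ _ _ _
  crossing_number_real measurable_crossing_number_real.

Definition crossingsRV (pi : {RV P >-> 'S_n}) : {RV P >-> R} :=
  [mfun of crossing_number_real \o pi].

End crossings.

Section standardize.
Context d (T : measurableType d) (R : realType) (P : probability T R).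
Variable X : {RV P >-> R}.

(* When the variance is 0 this is the constant 0, since 0^-1 = 0 in R. *)
Definition standardize_fun (w : T) : R :=
  (X w - fine 'E_P[X]) / Num.sqrt (fine 'V_P[X]).

Let measurable_standardize_fun : measurable_fun [set: T] standardize_fun.
Proof. by apply: measurable_funM => //; exact: measurable_funB. Qed.

HB.instance Definition _ := isMeasurableFun.Build _ _ _ _
  standardize_fun measurable_standardize_fun.

Definition standardize : {RV P >-> R} := [mfun of standardize_fun].

End standardize.

Definition kolmogorov_distance (R : realType) d (T : measurableType d)
    d' (T' : measurableType d') (P : probability T R) (Q : probability T' R)
    (X : {RV P >-> R}) (Y : {RV Q >-> R}) : \bar R :=
  ereal_sup [set `|cdf X x - cdf Y x|%E | x in [set: R]].

(* Main.v *)
(* For vertex-disjoint edges ab and cd, exactly one of the three perfect matchings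
   of the four places s a, s b, s c, s d is crossing. Summing over all such
   quadruples, the differences between the crossing indicator at s and at s with
   b and c exchanged add up to 12 (X - E X). Each exchange of two vertices yields
   an exchangeable pair, and Stein's method then bounds the Kolmogorov distance by
   E |1 - S1| + 4 E |S2|, where S1 has mean 1, S2 has mean 0, and both are sums of
   O(n^3) bounded terms depending only on the relative order of at most eight
   vertices. Relative orders on disjoint sets of vertices are independent, so both
   variances are O(1 / n). The crude constants suffice because the bound is
   vacuous unless n - 1 > 6270^2.

   The variance is computed by adding the edges of the path one at a time: two
   crossing indicators are uncorrelated as soon as one of them involves at most
   one vertex of the other, and the remaining covariances are found by enumerating
   the relative orders of at most six vertices. *)

Require Import Defs.
From HB Require Import structures.
From mathcomp Require Import all_boot all_order all_fingroup all_algebra.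
From mathcomp Require Import all_classical all_reals all_analysis.
From mathcomp Require Import measurable_realfun.
From mathcomp Require Import zify ring lra.

Set Implicit Arguments.
Unset Strict Implicit.
Unset Printing Implicit Defensive.

Import Order.TTheory GRing.Theory Num.Theory.
Import numFieldNormedType.Exports.

Local Open Scope classical_set_scope.
Local Open Scope ring_scope.

(** * The normal distribution and Stein's equation *)

Section normal_cdf.
Context {R : realType}.
Implicit Types x y z w : R.

(** No regression condition has to be checked: [W] is exactly a combination of functions [D k] that
    change sign under the k-th exchange, so E (W f(W)) is rewritten without remainder for every f.
    The obstacle is the corner of the Stein solution f at z, which rules out a second-order Taylor
    bound. Monotonicity replaces it: w f(w) increases and the indicator of w <= z decreases, so the
    first-order error between w and w' is at most (w - w') (H(w) - H(w')) with H increasing and |H|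
    <= 2. Antisymmetry then turns the averaged error into 2 E (S2 H). The rate is a count: each
    vertex lies in the supports of O(n^2) terms, so the unnormalised sums have variance O(n (n^2)^2)
    = O(n^5), against Var(X)^2 of order n^6. Up to there only degrees at most two and a positive
    variance are used; the exact variance enters at the end, through the lower bound n^3 / 90. *)

Definition npdf (x : R) : R := normal_pdf 0 1 x.
Definition ncdf (x : R) : R := fine (normal_prob 0 1 `]-oo, x]).

Lemma npdfE x : npdf x = normal_peak 1 * expR (- (x ^+ 2 / 2)).
Proof.
rewrite /npdf normal_pdfE ?oner_eq0// /normal_fun subr0 expr1n.
by rewrite mulNr.
Qed.

Lemma npdf_gt0 x : 0 < npdf x.
Proof. by rewrite npdfE mulr_gt0 ?expR_gt0// normal_peak_gt0 ?oner_eq0. Qed.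

Lemma npdfN x : npdf (- x) = npdf x.
Proof. by rewrite !npdfE sqrrN. Qed.

Lemma is_derive_npdf x : is_derive x 1 npdf (- x * npdf x).
Proof.
rewrite (_ : npdf = fun x => normal_peak 1 * expR (- (x ^+ 2 / 2))); last first.
  by apply/funext => y; exact: npdfE.
have h : is_derive x 1 (fun x : R => - (x ^+ 2 / 2)) (- x).
  apply: is_derive_eq; rewrite /GRing.scale/=; lra.
have := is_derive1_comp (is_derive_expR _) h.
move=> h2; apply: is_derive_eq; rewrite /GRing.scale/=; ring.
Qed.

(** As a random variable under the normal law itself, the identity has [ncdf] for its cdf, so the
    general limits of cdfs at infinity apply. *)
Let idR : measurableTypeR R -> R := idfun.
#[local] HB.instance Definition _ :=
  @isMeasurableFun.Build _ _ _ _ idR (@measurable_id _ _ setT).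

Let cdf_idR x :
  cdf (idR : {RV (normal_prob 0 1 : probability (measurableTypeR R) R) >-> R}) x =
  (ncdf x)%:E.
Proof.
rewrite /ncdf fineK //.
exact: fin_num_measure.
Qed.

Lemma ncdf_ge0 x : 0 <= ncdf x.
Proof. by rewrite fine_ge0. Qed.

Lemma ncdf_le1 x : ncdf x <= 1.
Proof. by rewrite -lee_fin -cdf_idR cdf_le1. Qed.

Lemma ncdfE :
  ncdf = (fun x : R => \int[lebesgue_measure]_(t in [set` `]-oo, x]]) npdf t)%R.
Proof. by []. Qed.

Lemma is_derive_ncdf x : is_derive x 1 ncdf (npdf x).
Proof.
rewrite ncdfE.
have x1 : x < x + 1 by rewrite ltrDl.
have i1 : (@lebesgue_measure R).-integrable `]-oo, x + 1] (EFin \o npdf).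
  apply: (integrableS _ _ (@subsetT _ _)) => //; exact: integrable_normal_pdf.
have c1 : {for x, continuous (npdf)}.
  exact: (@continuous_normal_pdf R 0 1 (oner_neq0 R) x).
have [h1 h2] := continuous_FTC1 x1 i1 (ltNyr _) c1.
by apply: (DeriveDef h1); rewrite -derive1E h2.
Qed.

Lemma ncdf_cvgy : ncdf x @[x --> +oo] --> (1 : R).
Proof.
have := cvg_cdfy1 (idR : {RV (normal_prob 0 1 : probability (measurableTypeR R) R) >-> R}).
rewrite (_ : cdf _ = fun x => (ncdf x)%:E); last by apply/funext => x; rewrite cdf_idR.
by move/fine_cvgP => [_].
Qed.

Lemma ncdf_cvgNy : ncdf x @[x --> -oo] --> (0 : R).
Proof.
have := cvg_cdfNy0 (idR : {RV (normal_prob 0 1 : probability (measurableTypeR R) R) >-> R}).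
rewrite (_ : cdf _ = fun x => (ncdf x)%:E); last by apply/funext => x; rewrite cdf_idR.
by move/fine_cvgP => [_].
Qed.

Lemma is_derive_inv (f : R -> R) (x df : R) : f x != 0 -> is_derive x 1 f df ->
  is_derive x 1 (fun t : R => (f t)^-1) (- (f x) ^- 2 * df).
Proof.
move=> fx0 [d1 d2]; apply: DeriveDef; first exact: derivableV.
by rewrite deriveV// d2.
Qed.

Lemma nondecreasing_is_derive (f df : R -> R) x y :
  (forall t : R, t \in `]x, y[ -> is_derive t 1 f (df t)) ->
  {within `[x, y], continuous f} ->
  (forall t, t \in `]x, y[ -> 0 <= df t) -> x <= y -> f x <= f y.
Proof.
move=> dfE cf df0; rewrite le_eqVlt => /predU1P[->//|xy].
have [c cxy e] := MVT xy dfE cf.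
by rewrite -subr_ge0 e mulr_ge0 ?df0// subr_ge0 ltW.
Qed.

Lemma continuous_is_derive (f df : R -> R) (A : set R) :
  (forall t : R, is_derive t 1 f (df t)) -> {within A, continuous f}.
Proof.
move=> dfE; apply: continuous_subspaceT => t.
by apply: differentiable_continuous; apply/derivable1_diffP; have [] := dfE t.
Qed.

(** Lets a monotonicity argument to the left of x start at a point where the boundary term is below
    any prescribed e. *)
Lemma ncdf_small x e : 0 < e -> exists2 y, y < x & ncdf y < e.
Proof.
move=> e0; have /cvgrPdist_lt /(_ e e0) := ncdf_cvgNy.
move=> [M [_ hM]]; exists (- (`|x| + `|M| + 1)).
  have := ler_norm (- x); have := normr_ge0 M; rewrite normrN; lra.
rewrite -[ltLHS]ger0_norm ?ncdf_ge0// -normrN -sub0r; apply: hM => /=.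
have := ler_norm (- M); have := normr_ge0 x; rewrite normrN; lra.
Qed.

Lemma npdf_small x e : 0 < e -> exists2 y, y < x & npdf y < e.
Proof.
move=> e0; set c : R := normal_peak 1.
have c0 : 0 < c by rewrite normal_peak_gt0 ?oner_eq0.
(* Since exp(y^2 / 2) >= 1 + y^2 / 2, it is enough that y^2 e > 2 c, which follows from y >= 1 and y
   e > 2 c. *)
exists (- (`|x| + 2 * c / e + 1)).
  have := ler_norm (- x); rewrite normrN => h.
  have : 0 < 2 * c / e by rewrite divr_gt0// mulr_gt0.
  by lra.
set y := _ + 1; have y1 : 1 <= y.
  rewrite /y; have := normr_ge0 x.
  have : 0 < 2 * c / e by rewrite divr_gt0// mulr_gt0.
  by lra.
have yc : 2 * c < y * e.
  rewrite -ltr_pdivrMr// /y; have := normr_ge0 x; lra.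
rewrite npdfE sqrrN -/c expRN.
have := expR_ge1Dx (y ^+ 2 / 2); set E := expR _ => hE.
have E0 : 0 < E by exact: expR_gt0.
rewrite ltr_pdivrMr//; nra.
Qed.

(** The sum [ncdf t + ncdf (- t)] has derivative 0 because the density is even, hence is constant,
    and its limit at infinity is 1. *)
Lemma ncdfN x : ncdf (- x) = 1 - ncdf x.
Proof.
pose g t : R := ncdf t + ncdf (- t).
have dg (t : R) : is_derive t 1 g 0.
  have h : is_derive t 1 (fun t : R => ncdf (- t)) (- npdf t).
    have hN : is_derive t 1 (fun t : R => - t) (- 1) by apply: is_derive_eq.
    have := @is_derive1_comp R ncdf -%R t _ _ (is_derive_ncdf (- t)) hN.
    by rewrite npdfN mulrN1.
  have := is_derive_ncdf t => h2.
  by apply: is_derive_eq; rewrite subrr.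
have gc t : g t = g 0.
  have [t0|t0] := leP t 0.
    apply/eqP; rewrite eq_le; apply/andP; split.
      apply: (@nondecreasing_is_derive g (fun=> 0)) => //; exact: (continuous_is_derive dg).
    rewrite -lerN2.
    apply: (@nondecreasing_is_derive (\- g) (fun=> 0)) => //.
      by move=> s _; apply: is_derive_eq; rewrite oppr0.
    by apply: (@continuous_is_derive _ (fun=> 0)) => s; apply: is_derive_eq; rewrite oppr0.
  move/ltW : t0 => t0; apply/eqP; rewrite eq_le; apply/andP; split; last first.
    apply: (@nondecreasing_is_derive g (fun=> 0)) => //; exact: (continuous_is_derive dg).
  rewrite -lerN2.
  apply: (@nondecreasing_is_derive (\- g) (fun=> 0)) => //.
    by move=> s _; apply: is_derive_eq; rewrite oppr0.
  by apply: (@continuous_is_derive _ (fun=> 0)) => s; apply: is_derive_eq; rewrite oppr0.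
have g1 : g t @[t --> +oo] --> (1 + 0 : R).
  apply: cvgD; first exact: ncdf_cvgy.
  by have := ncdf_cvgNy; rewrite cvgNy_compNP.
have g2 : g t @[t --> +oo] --> g 0.
  rewrite (_ : g = fun=> g 0); last by apply/funext => t; exact: gc.
  exact: cvg_cst.
have := cvg_unique (@norm_hausdorff _ _) g1 g2; rewrite addr0 -(gc x) /g => ->.
by rewrite addrAC subrr add0r.
Qed.

(* h decreases on ]-oo, 0[ and is at most ncdf, which tends to 0 at -oo. *)
Lemma mills_upper x : x < 0 -> - x * ncdf x <= npdf x.
Proof.
move=> x0; pose h t : R := ncdf t + npdf t * t^-1.
suff hx : h x <= 0.
  move: hx; rewrite /h; set a := ncdf x; set b := npdf x => hx.
  rewrite -subr_ge0 (_ : b - _ = x * (a + b * x^-1)); last by field; lra.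
  by rewrite nmulr_rge0// ltW.
apply/ler_addgt0Pl => e e0; rewrite addr0.
have [y yx ye] := ncdf_small x e0.
apply: (@le_trans _ _ (h y)); last first.
  rewrite /h; have : npdf y * y^-1 <= 0.
    by rewrite pmulr_rle0 ?npdf_gt0// invr_le0 ltW// (lt_trans yx).
  lra.
have dh (t : R) : t < 0 -> is_derive t 1 h (- npdf t * t^-1 ^+ 2).
  move=> t0; have tn0 : t != 0 by rewrite lt_eqF.
  have h1 := is_derive_ncdf t; have h2 := is_derive_npdf t.
  have h3 : is_derive t 1 (fun t : R => t^-1) (- t^-1 ^+ 2).
    by have := is_derive_inv tn0 (is_derive_id t 1); rewrite mulr1 exprVn.
  apply: is_derive_eq; rewrite /GRing.scale/=; field; exact: tn0.
rewrite -lerN2.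
apply: (@nondecreasing_is_derive (\- h) (fun t => npdf t * t^-1 ^+ 2)).
- move=> t /[!in_itv]/= /andP[_ tx].
  have := dh t (lt_trans tx x0) => h1.
  by apply: is_derive_eq; rewrite mulNr opprK.
- apply: derivable_within_continuous => t /[!in_itv]/= /andP[_ tx].
  have [h1 _] := dh t (le_lt_trans tx x0).
  exact: derivableN.
- by move=> t _; rewrite mulr_ge0 ?sqr_ge0// ltW// npdf_gt0.
- exact: ltW.
Qed.

(* k increases on the whole line, and k >= - npdf tends to 0 at -oo. *)
Lemma mills_lower x : - x * npdf x <= (1 + x ^+ 2) * ncdf x.
Proof.
pose k t : R := ncdf t + t * npdf t * (1 + t ^+ 2)^-1.
have q0 (t : R) : 0 < 1 + t ^+ 2 by rewrite ltr_pwDl// sqr_ge0.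
suff kx : 0 <= k x.
  move: kx; rewrite /k; set a := ncdf x; set b := npdf x => kx.
  rewrite -subr_ge0.
  rewrite (_ : _ - _ = (1 + x ^+ 2) * (a + x * b * (1 + x ^+ 2)^-1)); last first.
    by field; rewrite gt_eqF.
  by rewrite pmulr_rge0.
apply/ler_addgt0Pl => e e0.
have [y yx ye] := npdf_small x e0.
have ky : - e <= k y.
  rewrite /k; have := ncdf_ge0 y; set a := ncdf y => a0.
  suff : - npdf y <= y * npdf y * (1 + y ^+ 2)^-1 by lra.
  rewrite ler_pdivlMr//; have := ltW (npdf_gt0 y); set p := npdf y => p0.
  have := mulr_ge0 p0 (sqr_ge0 (y + 2^-1)); nra.
suff : k y <= k x by lra.
have dk (t : R) : is_derive t 1 k (npdf t * (2 / (1 + t ^+ 2) ^+ 2)).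
  have tn0 : 1 + t ^+ 2 != 0 by rewrite gt_eqF.
  have h1 := is_derive_ncdf t; have h2 := is_derive_npdf t.
  have h3 : is_derive t 1 (fun t : R => (1 + t ^+ 2)^-1) (- (2 * t) / (1 + t ^+ 2) ^+ 2).
    have h3 : is_derive t 1 (fun t : R => 1 + t ^+ 2) (2 * t).
      by apply: is_derive_eq; rewrite /GRing.scale/=; ring.
    by have := @is_derive_inv (fun t => 1 + t ^+ 2) t _ tn0 h3; rewrite mulNr mulrC mulNr.
  apply: is_derive_eq; rewrite /GRing.scale/=; field; exact: tn0.
apply: (@nondecreasing_is_derive k (fun t => npdf t * (2 / (1 + t ^+ 2) ^+ 2))).
- exact: (continuous_is_derive dk).
- by move=> t _; rewrite mulr_ge0// ?divr_ge0 ?sqr_ge0// ltW// npdf_gt0.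
- exact: ltW.
Qed.

End normal_cdf.

(** * The bounded solution of Stein's equation for a half-line *)

Section stein_solution.
Context {R : realType}.
Implicit Types x y z w : R.

(** The reflected Mills ratio: the usual one, (1 - ncdf) / npdf, is [mills (- x)]. Both branches of
    the Stein solution are constant multiples of these. *)
Definition mills x : R := ncdf x / npdf x.

Lemma is_derive_mills x : is_derive x 1 mills (1 + x * mills x).
Proof.
have p0 : npdf x != 0 by rewrite gt_eqF ?npdf_gt0.
have h1 := is_derive_ncdf x.
have h2 := is_derive_inv p0 (is_derive_npdf x).
apply: is_derive_eq; rewrite /GRing.scale/= /mills; field; exact: p0.
Qed.

Lemma mills_ge0 x : 0 <= mills x.
Proof. by rewrite divr_ge0 ?ncdf_ge0// ltW// npdf_gt0. Qed.

Lemma mulr_mills_geN1 x : -1 <= x * mills x.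
Proof.
have [x0|x0] := leP 0 x.
  by rewrite (@le_trans _ _ 0)// mulr_ge0// mills_ge0.
rewrite /mills mulrA ler_pdivlMr ?npdf_gt0//.
by have := mills_upper x0; lra.
Qed.

(** The derivative is [(1 + t ^+ 2) * mills t + t], and its nonnegativity is [mills_lower]. *)
Lemma mulr_mills_nondecreasing x y : x <= y -> x * mills x <= y * mills y.
Proof.
pose g t : R := t * mills t; rewrite -/(g x) -/(g y).
have dg (t : R) : is_derive t 1 g ((1 + t ^+ 2) * mills t + t).
  have h := is_derive_mills t.
  apply: is_derive_eq; rewrite /GRing.scale/=; ring.
apply: (@nondecreasing_is_derive _ _ (fun t => (1 + t ^+ 2) * mills t + t)) => //.
  exact: (continuous_is_derive dg).
move=> t _; have := mills_lower t; have p0 := npdf_gt0 t.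
rewrite /mills mulrA -lerBlDr sub0r ler_pdivlMr//; lra.
Qed.

Lemma mulr_millsN z : z * mills z * ncdf (- z) = - (- z * mills (- z) * ncdf z).
Proof. by rewrite /mills npdfN; ring. Qed.

Variable z : R.

(** The bounded solution f of f'(w) - w f(w) = 1 - ncdf z for w < z and - ncdf z for w > z. The two
    branches agree at z, where f has a corner. *)
Definition stein_sol w : R :=
  if w <= z then mills w * ncdf (- z) else mills (- w) * ncdf z.

(* The derivative of stein_sol wherever it exists, by Stein's equation. *)
Definition stein_deriv w : R := w * stein_sol w + (w <= z)%R%:R - ncdf z.

Lemma stein_sol_right w : z <= w -> stein_sol w = mills (- w) * ncdf z.
Proof.
rewrite /stein_sol le_eqVlt => /predU1P[<-|zw]; last by rewrite leNgt zw.
by rewrite lexx /mills npdfN; ring.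
Qed.

Lemma stein_sol_left w : w <= z -> stein_sol w = mills w * ncdf (- z).
Proof. by rewrite /stein_sol => ->. Qed.

Let mulr_stein_left w : w <= z -> w * stein_sol w = w * mills w * ncdf (- z).
Proof. by move=> wz; rewrite stein_sol_left// (mulrA w (mills w)). Qed.

Let mulr_stein_right w : z <= w ->
  w * stein_sol w = - (- w * mills (- w) * ncdf z).
Proof. by move=> wz; rewrite stein_sol_right// !mulNr opprK (mulrA w (mills _)). Qed.

(** On either side of z this is a nonnegative multiple of [t * mills t] at t = w, or of its opposite
    at t = - w; the two pieces are glued at z. *)
Lemma mulr_stein_sol_nondecreasing x y :
  x <= y -> x * stein_sol x <= y * stein_sol y.
Proof.
have L a b : a <= b -> b <= z -> a * stein_sol a <= b * stein_sol b.
  move=> ab bz; rewrite !mulr_stein_left ?(le_trans ab)//.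
  apply: ler_wpM2r; [exact: ncdf_ge0|exact: mulr_mills_nondecreasing].
have U a b : a <= b -> z <= a -> a * stein_sol a <= b * stein_sol b.
  move=> ab az; rewrite !mulr_stein_right ?(le_trans az)// lerN2.
  apply: ler_wpM2r; first exact: ncdf_ge0.
  by apply: mulr_mills_nondecreasing; rewrite lerN2.
move=> xy; have [yz|zy] := leP y z; first exact: L.
have [zx|xz] := leP z x; first exact: U.
by apply: le_trans (L x z (ltW xz) _) (U z y (ltW zy) _).
Qed.

Let nc0 x := @ncdf_ge0 R x.
Let nc1 x := @ncdf_le1 R x.
Let mz := mulr_mills_geN1 z.
Let mNz := mulr_mills_geN1 (- z).

(** By monotonicity [w * stein_sol w] stays between [- ncdf (- z)] and [ncdf z], which puts the
    derivative in [0, 1] left of z and in [-1, 0] right of it. The product of the two bounds lets a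
    rewrite use either one. *)
Lemma mulr_stein_sol_bounds w :
  (`|w * stein_sol w| <= 1) * (`|stein_deriv w| <= 1).
Proof.
rewrite /stein_deriv !ler_norml.
have q0 := nc0 z; have q1 := nc1 z; have p0 := nc0 (- z); have p1 := nc1 (- z).
have nN := ncdfN z; have mN := mulr_millsN z.
have a1 : 0 <= (z * mills z + 1) * ncdf (- z) by apply: mulr_ge0 => //; have := mz; lra.
have a2 : 0 <= (- z * mills (- z) + 1) * ncdf z by apply: mulr_ge0 => //; have := mNz; lra.
have [wz|/[dup] zw /ltW wz] := leP w z.
  have m1 := mulr_mills_geN1 w; have m2 := mulr_mills_nondecreasing wz.
  have a3 : 0 <= (w * mills w + 1) * ncdf (- z) by apply: mulr_ge0 => //; lra.
  have a4 : 0 <= (z * mills z - w * mills w) * ncdf (- z).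
    by rewrite mulr_ge0// subr_ge0.
  by rewrite mulr_stein_left// mulr1n; split; apply/andP; split; lra.
have m1 := mulr_mills_geN1 (- w).
have m2 : - w * mills (- w) <= - z * mills (- z).
  by rewrite mulr_mills_nondecreasing// lerN2.
have a3 : 0 <= (- w * mills (- w) + 1) * ncdf z by apply: mulr_ge0 => //; lra.
have a4 : 0 <= (- z * mills (- z) - - w * mills (- w)) * ncdf z.
  by apply: mulr_ge0 => //; rewrite subr_ge0.
by rewrite mulr_stein_right// mulr0n; split; apply/andP; split; lra.
Qed.

(** The mean value theorem applies on each side of z, and an interval containing z is cut there. The
    indicator decreases, so it is taken at [y] in the lower bound and at [x] in the upper one. *)
Lemma stein_sol_increment x y : x <= y ->
  (y - x) * (x * stein_sol x + (y <= z)%R%:R - ncdf z) <= stein_sol y - stein_sol x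
  <= (y - x) * (y * stein_sol y + (x <= z)%R%:R - ncdf z).
Proof.
have L a b : a <= b -> b <= z ->
  (b - a) * (a * stein_sol a + 1 - ncdf z) <= stein_sol b - stein_sol a
  <= (b - a) * (b * stein_sol b + 1 - ncdf z).
  rewrite le_eqVlt => /predU1P[->|ab bz]; first by rewrite !subrr !mul0r lexx.
  pose u t : R := mills t * ncdf (- z).
  have du (t : R) : is_derive t 1 u ((1 + t * mills t) * ncdf (- z)).
    have h := is_derive_mills t.
    by apply: is_derive_eq; rewrite /GRing.scale/=; ring.
  have cu : {within `[a, b], continuous u} by exact: (continuous_is_derive du).
  have [c /[!in_itv]/= /andP[ac cb]] := MVT ab (fun t _ => du t) cu.
  have cz : c <= z by rewrite (le_trans (ltW cb)).
  rewrite -[_ * ncdf _](_ : c * stein_sol c + 1 - ncdf z = _); last first.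
    by rewrite stein_sol_left// ncdfN; ring.
  rewrite /u -!stein_sol_left ?(le_trans (ltW ab))// => ->.
  have := mulr_stein_sol_nondecreasing (ltW ac).
  have := mulr_stein_sol_nondecreasing (ltW cb).
  rewrite ![_ * (b - a)]mulrC !ler_pM2l ?subr_gt0//; lra.
have U a b : a <= b -> z <= a ->
  (b - a) * (a * stein_sol a - ncdf z) <= stein_sol b - stein_sol a
  <= (b - a) * (b * stein_sol b - ncdf z).
  rewrite le_eqVlt => /predU1P[->|ab az]; first by rewrite !subrr !mul0r lexx.
  pose u t : R := mills (- t) * ncdf z.
  have du (t : R) : is_derive t 1 u ((t * mills (- t) - 1) * ncdf z).
    have hN : is_derive t 1 (fun t : R => - t) (- 1) by apply: is_derive_eq.
    have h := @is_derive1_comp R mills -%R t _ _ (is_derive_mills (- t)) hN.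
    by apply: is_derive_eq; rewrite /GRing.scale/=; ring.
  have cu : {within `[a, b], continuous u} by exact: (continuous_is_derive du).
  have [c /[!in_itv]/= /andP[ac cb]] := MVT ab (fun t _ => du t) cu.
  have cz : z <= c by rewrite (le_trans az)// ltW.
  rewrite -[_ * ncdf _](_ : c * stein_sol c - ncdf z = _); last first.
    by rewrite stein_sol_right//; ring.
  rewrite /u -!stein_sol_right ?(le_trans az (ltW ab))// => ->.
  have := mulr_stein_sol_nondecreasing (ltW ac).
  have := mulr_stein_sol_nondecreasing (ltW cb).
  rewrite ![_ * (b - a)]mulrC !ler_pM2l ?subr_gt0//; lra.
move=> xy; have [yz|zy] := leP y z; first by rewrite (le_trans xy yz); exact: L.
have [xz|zx] := leP x z; last first.
  by have := U _ _ xy (ltW zx); rewrite !addr0.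
have /andP[l1 l2] := L _ _ xz (lexx z).
have /andP[u1 u2] := U _ _ (ltW zy) (lexx z).
have m1 := mulr_stein_sol_nondecreasing xz.
have m2 := mulr_stein_sol_nondecreasing (ltW zy).
have zx0 : 0 <= z - x by rewrite subr_ge0.
have yz0 : 0 <= y - z by rewrite subr_ge0 ltW.
rewrite /=; apply/andP; split; nra.
Qed.

(** The right-hand side is a product of two increments of increasing functions, hence nonnegative in
    either order of w and w'; no smoothness at z is involved. *)
Lemma stein_sol_expansion w w' :
  `|stein_sol w - stein_sol w' - (w - w') * stein_deriv w| <=
  (w - w') * ((w * stein_sol w - (w <= z)%R%:R)
              - (w' * stein_sol w' - (w' <= z)%R%:R)).
Proof.
rewrite /stein_deriv ler_norml.
have mono x y : x <= y -> (y <= z)%R%:R <= (x <= z)%R%:R :> R.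
  by move=> xy; rewrite ler_nat; case: (leP y z) => // yz; rewrite (le_trans xy yz).
have [ww'|/ltW ww'] := leP w w'.
  have := stein_sol_increment ww'; have := mono _ _ ww'.
  have := mulr_stein_sol_nondecreasing ww'.
  move: (stein_sol w) (stein_sol w') => f f' m b /andP[h1 h2].
  apply/andP; split; nra.
have := stein_sol_increment ww'; have := mono _ _ ww'.
have := mulr_stein_sol_nondecreasing ww'.
move: (stein_sol w) (stein_sol w') => f f' m b /andP[h1 h2].
apply/andP; split; nra.
Qed.

End stein_solution.

(** * Stein's method for uniform averages over a finite set *)

Section average.
Context {R : realType} {I : finType}.
Hypothesis I0 : (0 < #|I|)%N.
Implicit Types f g : I -> R.

Definition avg f : R := (\sum_i f i) / #|I|%:R.

Lemma eq_avg f g : f =1 g -> avg f = avg g.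
Proof. by move=> fg; congr (_ / _); apply: eq_bigr. Qed.

Lemma avgD f g : avg (fun i => f i + g i) = avg f + avg g.
Proof. by rewrite /avg big_split mulrDl. Qed.

Lemma avgN f : avg (fun i => - f i) = - avg f.
Proof. by rewrite /avg sumrN mulNr. Qed.

Lemma avgB f g : avg (fun i => f i - g i) = avg f - avg g.
Proof. by rewrite avgD avgN. Qed.

Lemma avgZ c f : avg (fun i => c * f i) = c * avg f.
Proof. by rewrite /avg -mulr_sumr mulrA. Qed.

Lemma avg_sum (K : finType) (P : pred K) (F : K -> I -> R) :
  avg (fun i => \sum_(k | P k) F k i) = \sum_(k | P k) avg (F k).
Proof. by rewrite /avg exchange_big /= mulr_suml. Qed.

Lemma avg_cst c : avg (fun=> c) = c.
Proof.
by rewrite /avg sumr_const -[c *+ _]mulr_natr mulfK// pnatr_eq0 -lt0n.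
Qed.

Lemma ler_avg f g : (forall i, f i <= g i) -> avg f <= avg g.
Proof.
by move=> fg; rewrite ler_wpM2r ?invr_ge0// ler_sum.
Qed.

Lemma avg_ge0 f : (forall i, 0 <= f i) -> 0 <= avg f.
Proof. by move=> f0; rewrite divr_ge0// sumr_ge0. Qed.

Lemma ler_norm_avg f : `|avg f| <= avg (fun i => `|f i|).
Proof.
rewrite normrM [`|_^-1|]ger0_norm ?invr_ge0// ler_wpM2r ?invr_ge0//.
exact: ler_norm_sum.
Qed.

Lemma reindex_avg (h : I -> I) f : injective h -> avg (fun i => f (h i)) = avg f.
Proof.
move=> /injF_bij bh; congr (_ / _); rewrite [RHS](reindex h)//.
by apply: onW_bij.
Qed.

Lemma sqr_avg_le f : avg f ^+ 2 <= avg (fun i => f i ^+ 2).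
Proof.
rewrite -subr_ge0 (_ : _ - _ = avg (fun i => (f i - avg f) ^+ 2)); last first.
  rewrite (_ : avg (fun i => (f i - avg f) ^+ 2) =
      avg (fun i => f i ^+ 2 - (2 * avg f) * f i + avg f ^+ 2)).
    by rewrite avgD avgB avgZ avg_cst; ring.
  by apply: eq_avg => i; ring.
by apply: avg_ge0 => i; rewrite sqr_ge0.
Qed.

Lemma avg_norm_le_sqrt f v : avg (fun i => f i ^+ 2) <= v ->
  avg (fun i => `|f i|) <= Num.sqrt v.
Proof.
move=> fv; rewrite -[leLHS]ger0_norm ?avg_ge0// -sqrtr_sqr ler_wsqrtr//.
apply: le_trans (sqr_avg_le _) _.
by rewrite (eq_avg (g := fun i => f i ^+ 2))// => i; rewrite real_normK ?num_real.
Qed.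

Definition covar f g : R := avg (fun i => f i * g i) - avg f * avg g.

Lemma eq_covar f f' g g' : f =1 f' -> g =1 g' -> covar f g = covar f' g'.
Proof.
move=> ff' gg'; rewrite /covar (eq_avg ff') (eq_avg gg').
by rewrite (eq_avg (g := fun i => f' i * g' i))// => i; rewrite ff' gg'.
Qed.

Lemma covarC f g : covar f g = covar g f.
Proof.
rewrite /covar [avg f * _]mulrC; congr (_ - _).
by apply: eq_avg => i; rewrite mulrC.
Qed.

Lemma covarDl f f' g : covar (fun i => f i + f' i) g = covar f g + covar f' g.
Proof.
rewrite /covar avgD (eq_avg (g := fun i => f i * g i + f' i * g i)).
  by rewrite avgD; ring.
by move=> i; rewrite mulrDl.
Qed.

Lemma covarZl c f g : covar (fun i => c * f i) g = c * covar f g.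
Proof.
rewrite /covar avgZ (eq_avg (g := fun i => c * (f i * g i))).
  by rewrite avgZ; ring.
by move=> i; rewrite mulrA.
Qed.

Lemma covar_suml (K : finType) (P : pred K) (F : K -> I -> R) g :
  covar (fun i => \sum_(k | P k) F k i) g = \sum_(k | P k) covar (F k) g.
Proof.
rewrite /covar sumrB -[X in _ = _ - X]mulr_suml -(avg_sum P F).
rewrite -(avg_sum P (fun k i => F k i * g i)); congr (_ - _).
by apply: eq_avg => i; rewrite mulr_suml.
Qed.

Lemma covar_sumr (K : finType) (P : pred K) (F : K -> I -> R) g :
  covar g (fun i => \sum_(k | P k) F k i) = \sum_(k | P k) covar g (F k).
Proof. by rewrite covarC covar_suml; apply: eq_bigr => k _; rewrite covarC. Qed.

Lemma covar_center f : covar f f = avg (fun i => (f i - avg f) ^+ 2).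
Proof.
rewrite [RHS](_ : _ = avg (fun i => f i * f i - (2 * avg f) * f i + avg f ^+ 2)).
  by rewrite avgD avgB avgZ avg_cst /covar; ring.
by apply: eq_avg => i; ring.
Qed.

End average.

(* Exchangeable pairs (W, W o t k), indexed by k: since |D k| is symmetric while
   W - W o t k is antisymmetric, monotonicity of the two parts of the derivative
   of the Stein solution replaces the usual concentration inequality. *)
Section stein_bound.
Context {R : realType} {I K : finType}.
Hypothesis I0 : (0 < #|I|)%N.
Variables (P : pred K) (t : K -> I -> I) (D : K -> I -> R) (W : I -> R) (c : R).
Hypothesis tK : forall k, involutive (t k).
Hypothesis Dt : forall k i, D k (t k i) = - D k i.
Hypothesis c0 : 0 <= c.
Hypothesis WD : forall i, W i = c * \sum_(k | P k) D k i.

Let S1 i := c / 2 * \sum_(k | P k) D k i * (W i - W (t k i)).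
Let S2 i := c / 2 * \sum_(k | P k) `|D k i| * (W i - W (t k i)).

(** Reindexing by the involution [t k] turns the average of [E i * f (t k i)] into minus that of
    [E i * f i]. The factor 2 is what [c / 2] compensates. *)
Let avg_antisym k (E f : I -> R) : (forall i, E (t k i) = - E i) ->
  avg (fun i => E i * (f i - f (t k i))) = 2 * avg (fun i => E i * f i).
Proof.
move=> Et.
rewrite (_ : avg _ = avg (fun i => E i * f i - E i * f (t k i))); last first.
  by apply: eq_avg => i; rewrite mulrBr.
rewrite avgB mulrDl mul1r; congr (_ + _).
rewrite -[in RHS](reindex_avg (h := t k)); last exact: inv_inj.
by rewrite -avgN; apply: eq_avg => i; rewrite Et mulNr.
Qed.

Lemma avg_mul_stein (f : I -> R) : avg (fun i => W i * f i) =
  c / 2 * avg (fun i => \sum_(k | P k) D k i * (f i - f (t k i))).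
Proof.
rewrite avg_sum (_ : avg _ = avg (fun i => c * (\sum_(k | P k) D k i * f i))).
  rewrite avgZ avg_sum -mulrA; congr (_ * _); rewrite mulr_sumr.
  by apply: eq_bigr => k _; rewrite avg_antisym// mulKf ?pnatr_eq0.
by apply: eq_avg => i; rewrite WD -mulrA mulr_suml.
Qed.

Lemma avg_S1 : avg S1 = avg (fun i => W i ^+ 2).
Proof. by rewrite avgZ -avg_mul_stein. Qed.

Let absD_antisym k i :
  `|D k (t k i)| * (W (t k i) - W (t k (t k i))) = - (`|D k i| * (W i - W (t k i))).
Proof. by rewrite tK Dt normrN -mulrN opprB. Qed.

Lemma avg_S2 : avg S2 = 0.
Proof.
rewrite avgZ avg_sum big1 ?mulr0// => k _.
have := avg_antisym (fun=> 1) (absD_antisym k).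
rewrite (eq_avg (g := fun=> 0)); last by move=> i; rewrite subrr mulr0.
rewrite avg_cst// => /esym/eqP; rewrite mulf_eq0 pnatr_eq0 /= => /eqP <-.
by apply: eq_avg => i; rewrite mulr1.
Qed.

Theorem stein_exchangeable_bound z :
  `|avg (fun i => (W i <= z)%R%:R) - ncdf z| <=
  avg (fun i => `|1 - S1 i|) + 4 * avg (fun i => `|S2 i|).
Proof.
pose f := stein_sol z; pose F := stein_deriv z.
pose H w := w * f w - (w <= z)%R%:R.
pose err k i := f (W i) - f (W (t k i)) - (W i - W (t k i)) * F (W i).
have -> : avg (fun i => (W i <= z)%R%:R) - ncdf z =
    avg (fun i => F (W i) * (1 - S1 i)) -
    c / 2 * avg (fun i => \sum_(k | P k) D k i * err k i).
  rewrite -avgZ -avgB -[ncdf z](avg_cst I0) -avgB.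
  transitivity (avg (fun i => F (W i) - W i * f (W i))).
    by apply: eq_avg => i; rewrite /F /stein_deriv -/f; ring.
  rewrite avgB (avg_mul_stein (f \o W)) -avgZ -avgB; apply: eq_avg => i /=.
  rewrite /S1 mulrBr mulr1 -[RHS]addrA -opprD; congr (_ - _).
  rewrite (mulrCA (F _)) -mulrDr; congr (_ * _); rewrite mulr_sumr -big_split /=.
  by apply: eq_bigr => k _; rewrite /err; ring.
apply: le_trans (ler_normB _ _) _; apply: lerD.
  apply: le_trans (ler_norm_avg _) _; apply: ler_avg => i.
  by rewrite normrM ler_piMl// /F mulr_stein_sol_bounds.
have c20 : 0 <= c / 2 by rewrite divr_ge0.
rewrite normrM ger0_norm//.
apply: (@le_trans _ _ (c / 2 * avg (fun i => \sum_(k | P k)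
    `|D k i| * (W i - W (t k i)) * (H (W i) - H (W (t k i)))))).
  apply: ler_wpM2l => //; apply: le_trans (ler_norm_avg _) _; apply: ler_avg => i.
  apply: le_trans (ler_norm_sum _ _ _) _; apply: ler_sum => k _.
  rewrite normrM -mulrA ler_wpM2l//; exact: stein_sol_expansion.
rewrite avg_sum.
(* [|D k i| * (W i - W (t k i))] is antisymmetric, so the difference of [H] becomes [2 * H] and the
   remainder is twice the average of [S2 * H]. With |H| <= 1 + 1 this gives the constant 4. *)
under eq_bigr => k _ do rewrite (avg_antisym (H \o W) (absD_antisym k)).
rewrite -mulr_sumr -avg_sum mulrCA -[c / 2 * avg _]avgZ.
rewrite (eq_avg (g := fun i => S2 i * H (W i))); last first.
  by move=> i; rewrite /S2 !mulr_sumr mulr_suml; apply: eq_bigr => k _ /=; ring.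
rewrite (_ : 4 = 2 * 2 :> R); last by ring.
rewrite -[leRHS]mulrA ler_wpM2l//.
apply: le_trans (ler_norm _) _; apply: le_trans (ler_norm_avg _) _.
rewrite -avgZ; apply: ler_avg => i.
rewrite normrM mulrC ler_wpM2r// /H; apply: le_trans (ler_normB _ _) _.
rewrite (_ : 2 = 1 + 1); last by ring.
apply: lerD; first by rewrite mulr_stein_sol_bounds.
by rewrite normr_nat lern1; case: (_ <= _).
Qed.

End stein_bound.

(** * Functions of the relative order of few vertices *)

Lemma card_perm_gt0 {n} : (0 < #|'S_n|)%N.
Proof. by apply/card_gt0P; exists 1%g. Qed.

Section order_local.
Context {R : realType} {n : nat}.
Implicit Types (A B : {set 'I_n}) (s t : 'S_n) (h g : 'S_n -> R).

Definition same_order A s s' :=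
  forall u v, u \in A -> v \in A -> (s u < s v)%N = (s' u < s' v)%N.

Definition order_local A h := forall s s', same_order A s s' -> h s = h s'.

Let ranked A s : seq 'I_n := sort (fun u v => s u <= s v)%N (enum A).

Let mem_ranked A s : ranked A s =i A.
Proof. by move=> u; rewrite mem_sort mem_enum. Qed.

Let size_ranked A s : size (ranked A s) = #|A|.
Proof. by rewrite size_sort -cardE. Qed.

Let uniq_ranked A s : uniq (ranked A s).
Proof. by rewrite sort_uniq enum_uniq. Qed.

Let index_ranked A s u v : u \in A -> v \in A ->
  (index u (ranked A s) < index v (ranked A s))%N = (s u < s v)%N.
Proof.
move=> uA vA.
have tr : transitive (fun u v : 'I_n => s u <= s v)%N.
  by move=> y x z /leq_trans; apply.
have so : sorted (fun u v => s u <= s v)%N (ranked A s).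
  by apply: sort_sorted => x y; exact: leq_total.
have le x y : x \in A -> y \in A ->
    (index x (ranked A s) <= index y (ranked A s))%N -> (s x <= s y)%N.
  by move=> xA yA; apply: (sorted_leq_index tr _ so); rewrite ?mem_ranked// => z.
apply/idP/idP; last first.
  by apply: contraTT; rewrite -!leqNgt ; exact: le.
move=> uv; rewrite ltn_neqAle le ?(ltnW uv)// andbT.
apply: contraTN uv => /eqP/val_inj/perm_inj ->.
by rewrite ltnn.
Qed.

(** The relabelling sends the vertex of a given rank in [A] under [s] to the vertex of the same rank
    under [s'], and fixes the vertices outside [A]. *)
Lemma order_alignment A s s' :
  exists2 r : 'S_n, perm_on A r & same_order A (r * s')%g s.
Proof.
pose f u := if u \in A then nth u (ranked A s') (index u (ranked A s)) else u.
have lti u : u \in A -> (index u (ranked A s) < size (ranked A s'))%N.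
  by move=> uA; rewrite size_ranked -(size_ranked A s) index_mem mem_ranked.
have fA u : u \in A -> f u \in A.
  by move=> uA; rewrite /f uA -(mem_ranked _ s') mem_nth// lti.
have fi u : u \in A -> index (f u) (ranked A s') = index u (ranked A s).
  by move=> uA; rewrite {1}/f uA index_uniq ?uniq_ranked// lti.
have finj : injective f.
  move=> u v fuv; have [uA|uA] := boolP (u \in A); have [vA|vA] := boolP (v \in A).
  - have : index u (ranked A s) = index v (ranked A s) by rewrite -!fi// fuv.
    have [us vs] : u \in ranked A s /\ v \in ranked A s by rewrite !mem_ranked.
    by move=> e; rewrite -(nth_index u us) e nth_index.
  - by have := fA u uA; rewrite fuv {1}/f (negbTE vA) (negbTE vA).
  - by have := fA v vA; rewrite -fuv {1}/f (negbTE uA) (negbTE uA).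
  - by move: fuv; rewrite /f (negbTE uA) (negbTE vA).
exists (perm finj).
  by apply/fintype.subsetP => u; rewrite inE permE /f; case: ifP => //; rewrite eqxx.
move=> u v uA vA; rewrite !permM !permE.
by rewrite -(index_ranked s' (fA u uA) (fA v vA)) !fi// index_ranked.
Qed.

Let sym_sum A h s := \sum_(r : 'S_n | perm_on A r) h (r * s)%g.

Let sym_sum_cst A h s s' : order_local A h -> sym_sum A h s = sym_sum A h s'.
Proof.
move=> hA; have [r rA rs] := order_alignment A s s'.
have rV : perm_on A r^-1%g by exact: perm_onV.
rewrite /sym_sum [RHS](reindex (fun t => t * r)%g) /=; last first.
  by exists (fun t => t * r^-1)%g => t _; rewrite ?mulgK ?mulgKV.
apply: eq_big => [t|t tA].
  apply/idP/idP => [tA|trA]; first exact: perm_onM.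
  by rewrite -(mulgK r t); exact: perm_onM.
rewrite -mulgA; apply: hA => u v uA vA.
rewrite !permM -(rs (t u) (t v)) ?permM//; by rewrite perm_closed.
Qed.

(** Independence by symmetrization: summing over the relabellings of [A] replaces [h] by
    [sym_sum A h], which is constant by [order_alignment], while [g] does not notice them. *)
Lemma avg_mul_order_local A h g : order_local A h ->
    (forall t s, perm_on A t -> g (t * s)%g = g s) ->
  avg (fun s => h s * g s) = avg h * avg g.
Proof.
move=> hA gA; pose N : R := #|[set t : 'S_n | perm_on A t]%SET|%:R.
have N0 : N != 0.
  rewrite pnatr_eq0 -lt0n; apply/card_gt0P; exists 1%g; rewrite inE.
  exact: perm_on1.
have main f : (forall t s, perm_on A t -> f (t * s)%g = f s) ->
    N * avg (fun s => h s * f s) = sym_sum A h 1%g * avg f.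
  move=> fA.
  rewrite -[RHS]avgZ [RHS](eq_avg (g := fun s => sym_sum A h s * f s)); last first.
    by move=> s; congr (_ * _); exact: sym_sum_cst.
  transitivity (\sum_(r : 'S_n | perm_on A r) avg (fun s => h s * f s)).
    rewrite sumr_const -mulr_natl; congr (_%:R * _).
    by apply: eq_card => t; rewrite !inE.
  rewrite [RHS](eq_avg (g := fun s => \sum_(r | perm_on A r) h (r * s)%g * f s)); last first.
    by move=> s; rewrite /sym_sum mulr_suml.
  rewrite avg_sum; apply: eq_bigr => r rA.
  rewrite -(reindex_avg (h := fun s => r * s)%g); last exact: mulgI.
  by apply: eq_avg => s; rewrite fA.
have e1 := main g gA; have e2 := main (fun=> 1) (fun _ _ _ => erefl).
apply: (mulfI N0); rewrite e1 [RHS]mulrA; congr (_ * _).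
move: e2; rewrite (avg_cst card_perm_gt0) mulr1 => <-; congr (_ * _).
by apply: eq_avg => s; rewrite mulr1.
Qed.

Lemma order_local_invariant A B g : [disjoint A & B]%B -> order_local B g ->
  forall t s, perm_on A t -> g (t * s)%g = g s.
Proof.
move=> AB gB t s tA; apply: gB => u v uB vB.
by rewrite !permM !(out_perm tA) ?(disjointFl AB).
Qed.

Lemma covar_order_local A B h g : [disjoint A & B]%B -> order_local A h ->
  order_local B g -> covar h g = 0.
Proof.
move=> AB hA gB; rewrite /covar (avg_mul_order_local hA) ?subrr//.
exact: order_local_invariant AB gB.
Qed.

(** Pairs k, l with disjoint supports contribute 0 and the others at most 2. The square counts each
    intersecting pair once for every common vertex, so at least once. *)
Lemma covar_sum_order_local (K : finType) (P : pred K) (V : K -> {set 'I_n})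
    (h : K -> 'S_n -> R) :
  (forall k, P k -> order_local (V k) (h k)) ->
  (forall k s, P k -> `|h k s| <= 1) ->
  let H s := \sum_(k | P k) h k s in
  covar H H <= 2 * \sum_v (\sum_(k | P k) (v \in V k)%:R) ^+ 2.
Proof.
move=> hV h1 /=.
rewrite covar_suml.
have -> : \sum_v (\sum_(k | P k) (v \in V k)%:R) ^+ 2 =
    \sum_(k | P k) \sum_(l | P l) \sum_v ((v \in V k)%:R * (v \in V l)%:R : R).
  under eq_bigr => v _ do rewrite expr2 mulr_suml.
  rewrite exchange_big /=; apply: eq_bigr => k _.
  rewrite [RHS]exchange_big /=; apply: eq_bigr => v _.
  by rewrite mulr_sumr.
rewrite mulr_sumr; apply: ler_sum => k Pk; rewrite covar_sumr mulr_sumr.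
apply: ler_sum => l Pl.
have [dj|] := boolP [disjoint V k & V l]%B.
  rewrite (covar_order_local dj (hV _ Pk) (hV _ Pl)).
  by rewrite mulr_ge0// sumr_ge0// => v _; rewrite mulr_ge0.
rewrite -finset.setI_eq0 => /finset.set0Pn[v]; rewrite inE => /andP[vk vl].
have le1 : 1 <= \sum_v ((v \in V k)%:R * (v \in V l)%:R : R).
  by rewrite (bigD1 v)//= vk vl mulr1 lerDl sumr_ge0// => u _; rewrite mulr_ge0.
suff : covar (h k) (h l) <= 2 by lra.
rewrite /covar (_ : 2 = 1 + 1); last by ring.
have a1 k0 : P k0 -> `|avg (h k0)| <= 1.
  move=> Pk0; apply: le_trans (ler_norm_avg _) _.
  by rewrite -[leRHS](avg_cst (@card_perm_gt0 n)); apply: ler_avg => s; exact: h1.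
apply: lerD.
  rewrite -[leRHS](avg_cst (@card_perm_gt0 n)); apply: ler_avg => s.
  by rewrite (le_trans (ler_norm _))// normrM mulr_ile1 ?h1.
by rewrite (le_trans (ler_norm _))// normrN normrM mulr_ile1 ?a1.
Qed.

End order_local.

(** * Crossings of a graph of maximal degree two *)

(** The unoriented crossing of the chords xy and zw; [interlaced] is the oriented pattern that
    occurs in [crossing]. *)
Definition alternate (x y z w : nat) : bool :=
  ((x < z < y) || (y < z < x))%N (+) ((x < w < y) || (y < w < x))%N.

Definition interlaced (x y z w : nat) : bool := [&& z < x, y < z & w < y]%N.

(** Two crossing chords can be oriented downwards and ordered by their upper ends in exactly one of
    the eight ways. *)
Lemma alternateE x y z w : uniq [:: x; y; z; w] -> alternate x y z w =
  (interlaced x y z w + interlaced y x z w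
   + interlaced x y w z + interlaced y x w z
   + (interlaced z w x y + interlaced w z x y
      + interlaced z w y x + interlaced w z y x))%N :> nat.
Proof.
rewrite /alternate /interlaced /= !inE !negb_or -!andbA.
move=> /and5P[xy xz xw yz /and3P[yw zw _]].
case: (ltngtP x y) xy => // xy _; case: (ltngtP x z) xz => // xz _;
case: (ltngtP x w) xw => // xw _; case: (ltngtP y z) yz => // yz _;
case: (ltngtP y w) yw => // yw _; case: (ltngtP z w) zw => // zw _;
by [] || (exfalso; lia).
Qed.

Lemma alternate_matchings x y z w : uniq [:: x; y; z; w] ->
  (alternate x y z w + alternate x z y w + alternate x w z y = 1)%N.
Proof.
rewrite /alternate /= !inE !negb_or -!andbA.
move=> /and5P[xy xz xw yz /and3P[yw zw _]]; lia.
Qed.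

Section quadruples.
Context {n : nat} (e : rel 'I_n).
Hypothesis esym : symmetric e.
Hypothesis edeg : forall u, (\sum_v e u v <= 2)%N.

Local Notation quad := ('I_n * 'I_n * 'I_n * 'I_n)%type.
Implicit Types (q k : quad) (s : 'S_n).

Definition disjoint_edges q :=
  let: (a, b, c, d) := q in [&& e a b, e c d & uniq [:: a; b; c; d]].

Definition chords_cross s q :=
  let: (a, b, c, d) := q in alternate (s a) (s b) (s c) (s d).

Definition swap_mid q : 'S_n := let: (_, b, c, _) := q in tperm b c.

(** The three involutions generate the eight quadruples that present the same unordered pair of
    undirected edges. *)
Let swap1 q : quad := let: (a, b, c, d) := q in (b, a, c, d).
Let swap2 q : quad := let: (a, b, c, d) := q in (a, b, d, c).
Let swap3 q : quad := let: (a, b, c, d) := q in (c, d, a, b).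

Let disjoint_swap1 q : disjoint_edges (swap1 q) = disjoint_edges q.
Proof.
case: q => [[[a b] c] d]; rewrite /swap1 /swap2 /swap3 /disjoint_edges (esym b a).
congr (_ && (_ && _)).
apply: perm_uniq; by rewrite (perm_catCA [:: b] [:: a] [:: c; d]).
Qed.

Let disjoint_swap2 q : disjoint_edges (swap2 q) = disjoint_edges q.
Proof.
case: q => [[[a b] c] d]; rewrite /swap1 /swap2 /swap3 /disjoint_edges (esym d c).
congr (_ && (_ && _)).
apply: perm_uniq; by rewrite !perm_cons (perm_catCA [:: d] [:: c] [::]).
Qed.

Let disjoint_swap3 q : disjoint_edges (swap3 q) = disjoint_edges q.
Proof.
case: q => [[[a b] c] d]; rewrite /swap1 /swap2 /swap3 /disjoint_edges andbCA.
congr (_ && (_ && _)).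
apply: perm_uniq; by rewrite (perm_catC [:: c; d] [:: a; b]).
Qed.

Let sum_swap (M : nmodType) (h : quad -> quad) (F : quad -> M) :
  involutive h -> (forall q, disjoint_edges (h q) = disjoint_edges q) ->
  \sum_(q | disjoint_edges q) F (h q) = \sum_(q | disjoint_edges q) F q.
Proof.
move=> hK hd; rewrite [RHS](reindex h); last by exists h => q _; exact: hK.
by apply: eq_bigl => q; rewrite hd.
Qed.

Let swap1K : involutive swap1. Proof. by case=> [[[a b] c] d]. Qed.
Let swap2K : involutive swap2. Proof. by case=> [[[a b] c] d]. Qed.
Let swap3K : involutive swap3. Proof. by case=> [[[a b] c] d]. Qed.

Let uniq_image s a b c d : uniq [:: a; b; c; d] ->
  uniq [:: nat_of_ord (s a); nat_of_ord (s b); nat_of_ord (s c); nat_of_ord (s d)].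
Proof.
move=> u; have := map_inj_uniq (inj_comp val_inj (@perm_inj _ s)) [:: a; b; c; d].
by rewrite u.
Qed.

Lemma sum_chords_cross s :
  (\sum_(q | disjoint_edges q) chords_cross s q = 8 * crossing_number e s)%N.
Proof.
pose O q : nat := let: (a, b, c, d) := q in interlaced (s a) (s b) (s c) (s d).
have -> : crossing_number e s = (\sum_(q | disjoint_edges q) O q)%N.
  rewrite /crossing_number -sum1_card big_mkcond [RHS]big_mkcond /=.
  apply: eq_bigr => -[[[a b] c] d] _; rewrite inE /= /interlaced.
  case: (e a b) => //; case: (e c d) => //=.
  have [/and3P[h1 h2 h3]|] := boolP (_ && _); last by case: ifP.
  rewrite ifT// !inE !negb_or -!andbA.
  by apply/and5P; split; last (apply/and3P; split => //);
    apply/negP => /eqP eab; move: h1 h2 h3; rewrite ?eab; lia.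
have S1 (F : quad -> nat) : (\sum_(q | disjoint_edges q) F (swap1 q) =
    \sum_(q | disjoint_edges q) F q)%N := sum_swap F swap1K disjoint_swap1.
have S2 (F : quad -> nat) : (\sum_(q | disjoint_edges q) F (swap2 q) =
    \sum_(q | disjoint_edges q) F q)%N := sum_swap F swap2K disjoint_swap2.
have S3 (F : quad -> nat) : (\sum_(q | disjoint_edges q) F (swap3 q) =
    \sum_(q | disjoint_edges q) F q)%N := sum_swap F swap3K disjoint_swap3.
transitivity (\sum_(q | disjoint_edges q) (O q + O (swap1 q) + O (swap2 q)
  + O (swap1 (swap2 q)) + (O (swap3 q) + O (swap1 (swap3 q))
  + O (swap2 (swap3 q)) + O (swap1 (swap2 (swap3 q))))))%N.
  apply: eq_bigr => -[[[a b] c] d] /= /and3P[_ _ u].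
  by rewrite alternateE//; exact: uniq_image.
rewrite !big_split /= (S3 (fun q => O (swap1 (swap2 q)))) (S3 (fun q => O (swap1 q))).
rewrite (S3 (fun q => O (swap2 q))) (S2 (fun q => O (swap1 q))) (S3 O) (S2 O) (S1 O).
by rewrite !mulSn mul0n addn0 !addnA.
Qed.

Lemma swap_midE s a b c d : uniq [:: a; b; c; d] ->
  chords_cross (swap_mid (a, b, c, d) * s) (a, b, c, d) =
  alternate (s a) (s c) (s b) (s d).
Proof.
rewrite /= !inE !negb_or -!andbA => /and5P[ab ac ad bc /and3P[bd cd _]].
rewrite !permM tpermL tpermR !tpermD// 1?eq_sym//.
Qed.

(** Exchanging b and c replaces the matching ab|cd by ac|bd. Summed over all quadruples, ac|bd and
    ad|bc count the same, by symmetry in c and d; hence the factor 2. *)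
Lemma sum_chords_cross_swap s :
  (\sum_(q | disjoint_edges q) chords_cross s q +
   2 * \sum_(q | disjoint_edges q) chords_cross (swap_mid q * s)%g q =
   \sum_(q | disjoint_edges q) 1)%N.
Proof.
pose A1 q : nat := let: (a, b, c, d) := q in alternate (s a) (s c) (s b) (s d).
have -> : (\sum_(q | disjoint_edges q) chords_cross (swap_mid q * s)%g q =
    \sum_(q | disjoint_edges q) A1 q)%N.
  apply: eq_bigr => -[[[a b] c] d] /and3P[_ _ u].
  by congr nat_of_bool; exact: swap_midE.
have S2 : (\sum_(q | disjoint_edges q) A1 (swap2 q) =
    \sum_(q | disjoint_edges q) A1 q)%N := sum_swap A1 swap2K disjoint_swap2.
rewrite mul2n -addnn -[X in (_ + (_ + X))%N]S2.
rewrite addnA -!big_split; apply: eq_bigr => -[[[a b] c] d] /= /and3P[_ _ u].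
rewrite -(alternate_matchings (uniq_image s u)); congr (_ + _)%N.
by congr nat_of_bool; rewrite /alternate addbC.
Qed.

End quadruples.

(** * Counting quadruples around a vertex *)

Section counting.
Context {n : nat} (e : rel 'I_n).
Hypothesis esym : symmetric e.
Hypothesis edeg : forall u, (\sum_v e u v <= 2)%N.

Local Notation quad := ('I_n * 'I_n * 'I_n * 'I_n)%type.
Implicit Types (q k : quad).
Local Notation disjoint_edges := (disjoint_edges e).

Definition occ (x : 'I_n) q : nat :=
  let: (a, b, c, d) := q in ((x == a) + (x == b) + (x == c) + (x == d))%N.

(** Exchanging the middle vertices of [k] can affect the crossing indicator of [q] only in this
    case; see [cross_diff_unlinked]. *)
Definition meets_mid q k : bool :=
  let: (_, b, c, _) := k in (0 < occ b q)%N || (0 < occ c q)%N.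

Definition support2 (p : quad * quad) : {set 'I_n} :=
  [set v | (0 < occ v p.1)%N || (0 < occ v p.2)%N]%SET.

Let sum_quad (F : quad -> nat) :
  (\sum_q F q = \sum_a \sum_b \sum_c \sum_d F (a, b, c, d))%N.
Proof.
rewrite !pair_bigA /=.
by apply: eq_bigr => -[[[a b] c] d].
Qed.

Let edges2 : (\sum_c \sum_d e c d <= 2 * n)%N.
Proof.
apply: leq_trans (leq_sum _ (fun c _ => edeg c)) _.
by rewrite sum_nat_const card_ord mulnC.
Qed.

Let prod_le (f g : 'I_n -> 'I_n -> nat) m1 m2 :
  (\sum_a \sum_b f a b <= m1)%N -> (\sum_c \sum_d g c d <= m2)%N ->
  (\sum_a \sum_b \sum_c \sum_d f a b * g c d <= m1 * m2)%N.
Proof.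
move=> f2 g2; apply: leq_trans (leq_mul f2 g2).
rewrite big_distrl; apply: leq_sum => a _ /=; rewrite big_distrl.
apply: leq_sum => b _ /=; rewrite big_distrr; apply: leq_sum => c _ /=.
by rewrite big_distrr.
Qed.

Let deg_left u : (\sum_a \sum_b e a b * (a == u) <= 2)%N.
Proof.
under eq_bigr => a _ do rewrite -big_distrl /=.
rewrite (bigD1 u)//= eqxx muln1 [X in (_ + X)%N]big1 ?addn0 => [|a /negPf ->]; first exact: edeg.
by rewrite muln0.
Qed.

Let deg_right u : (\sum_a \sum_b e a b * (b == u) <= 2)%N.
Proof.
rewrite exchange_big /=; apply: leq_trans (deg_left u).
by apply: leq_sum => a _; apply: leq_sum => b _; rewrite esym.
Qed.

Let count_at (pos : 'I_n -> 'I_n -> 'I_n -> 'I_n -> 'I_n) u :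
    (\sum_a \sum_b \sum_c \sum_d (e a b * e c d) * (pos a b c d == u) <= 4 * n)%N ->
  (\sum_(q | disjoint_edges q)
    (let: (a, b, c, d) := q in pos a b c d == u) <= 4 * n)%N.
Proof.
apply: leq_trans; rewrite big_mkcond sum_quad /=.
do 4 (apply: leq_sum => ? _); case: ifP => // /and3P[-> -> _].
by rewrite !mul1n.
Qed.

Let count_a u :
  (\sum_(q | disjoint_edges q) (let: (a, b, c, d) := q in a == u) <= 4 * n)%N.
Proof.
apply: (count_at (pos := fun a b c d => a)).
rewrite -[4%N]/(2 * 2)%N -mulnA; apply: leq_trans (prod_le (deg_left u) edges2).
by do 4 (apply: leq_sum => ? _); rewrite mulnAC.
Qed.

Let count_b u :
  (\sum_(q | disjoint_edges q) (let: (a, b, c, d) := q in b == u) <= 4 * n)%N.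
Proof.
apply: (count_at (pos := fun a b c d => b)).
rewrite -[4%N]/(2 * 2)%N -mulnA; apply: leq_trans (prod_le (deg_right u) edges2).
by do 4 (apply: leq_sum => ? _); rewrite mulnAC.
Qed.

Let count_c u :
  (\sum_(q | disjoint_edges q) (let: (a, b, c, d) := q in c == u) <= 4 * n)%N.
Proof.
apply: (count_at (pos := fun a b c d => c)).
rewrite -[4%N]/(2 * 2)%N mulnAC; apply: leq_trans (prod_le edges2 (deg_left u)).
by do 4 (apply: leq_sum => ? _); rewrite mulnA.
Qed.

Let count_d u :
  (\sum_(q | disjoint_edges q) (let: (a, b, c, d) := q in d == u) <= 4 * n)%N.
Proof.
apply: (count_at (pos := fun a b c d => d)).
rewrite -[4%N]/(2 * 2)%N mulnAC; apply: leq_trans (prod_le edges2 (deg_right u)).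
by do 4 (apply: leq_sum => ? _); rewrite mulnA.
Qed.

(** Once a position holds [u], its edge has at most 2 choices and the other oriented edge at most
    2n; there are four positions. *)
Lemma sum_occ_le u : (\sum_(q | disjoint_edges q) occ u q <= 16 * n)%N.
Proof.
apply: (@leq_trans (4 * n + 4 * n + 4 * n + 4 * n)); last by lia.
have h := leq_add (leq_add (leq_add (count_a u) (count_b u)) (count_c u)) (count_d u).
apply: leq_trans h; rewrite -!big_split /=.
by apply: leq_sum => -[[[a b] c] d] _ /=; rewrite !(eq_sym u).
Qed.

Let sum_occ_mid q (pos : quad -> 'I_n) :
  (forall u, \sum_(k | disjoint_edges k) (pos k == u) <= 4 * n)%N ->
  (\sum_(k | disjoint_edges k) occ (pos k) q <= 16 * n)%N.
Proof.
move=> h; case: q => [[[a b] c] d] /=.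
apply: (@leq_trans (4 * n + 4 * n + 4 * n + 4 * n)); last by lia.
apply: leq_trans (leq_add (leq_add (leq_add (h a) (h b)) (h c)) (h d)).
by rewrite -!big_split.
Qed.

Let mid1 (k : quad) := let: (_, b, _, _) := k in b.
Let mid2 (k : quad) := let: (_, _, c, _) := k in c.

Let sum_occ_mid1 q : (\sum_(k | disjoint_edges k) occ (mid1 k) q <= 16 * n)%N.
Proof.
apply: sum_occ_mid => u; apply: leq_trans (count_b u).
by apply: leq_sum => -[[[a b] c] d].
Qed.

Let sum_occ_mid2 q : (\sum_(k | disjoint_edges k) occ (mid2 k) q <= 16 * n)%N.
Proof.
apply: sum_occ_mid => u; apply: leq_trans (count_c u).
by apply: leq_sum => -[[[a b] c] d].
Qed.

Definition linked (p : quad * quad) : bool :=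
  [&& disjoint_edges p.1, disjoint_edges p.2 & meets_mid p.2 p.1].

(** If [v] lies in k, there are at most 16n choices of k (with multiplicity), then at most 32n of q
    containing one of its two middle vertices. If [v] lies in q, choose q first and then k. Each
    case gives 512 n^2. *)
Lemma count_support2 v :
  (\sum_(p | linked p) (v \in support2 p) <= 1024 * n ^ 2)%N.
Proof.
have lt0D (m1 m2 : nat) : (((0 < m1) || (0 < m2)) <= m1 + m2)%N.
  by case: m1 => //; case: m2.
apply: (@leq_trans (\sum_(k | disjoint_edges k) \sum_(q | disjoint_edges q)
   ((occ (mid1 k) q + occ (mid2 k) q) * (occ v k + occ v q)))%N).
  rewrite pair_big /= big_mkcond [leqRHS]big_mkcond /=.
  apply: leq_sum => -[k q] _; rewrite /linked /=.
  case: (disjoint_edges k) => //=; case: (disjoint_edges q) => //=.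
  case: ifP => //; rewrite inE /= => hk.
  apply: leq_trans (lt0D _ _) _; rewrite -[leqLHS]mul1n leq_mul//.
  apply: leq_trans (lt0D _ _); move: hk.
  by case: k => [[[a b] c] d] /= ->.
under eq_bigr => k _ do under eq_bigr => q _ do rewrite mulnDr.
under eq_bigr => k _ do rewrite big_split /=.
rewrite big_split /=.
have -> : (1024 * n ^ 2 = 16 * n * (32 * n) + 16 * n * (32 * n))%N by lia.
apply: leq_add.
  apply: (@leq_trans (\sum_(k | disjoint_edges k) occ v k * (32 * n))%N).
    apply: leq_sum => k _; rewrite -big_distrl /= mulnC; apply: leq_mul => //.
    rewrite big_split /=; apply: leq_trans (leq_add (sum_occ_le _) (sum_occ_le _)) _.
    by lia.
  by rewrite -big_distrl /= leq_mul// sum_occ_le.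
rewrite exchange_big /=.
apply: (@leq_trans (\sum_(q | disjoint_edges q) occ v q * (32 * n))%N).
  apply: leq_sum => q _; rewrite -big_distrl /= mulnC; apply: leq_mul => //.
  rewrite big_split /=; apply: leq_trans (leq_add (sum_occ_mid1 _) (sum_occ_mid2 _)) _.
  by lia.
by rewrite -big_distrl /= leq_mul// sum_occ_le.
Qed.

End counting.

(** * The Kolmogorov bound in terms of the variance *)

Section kolmogorov_bound.
Context {R : realType} {n : nat} (e : rel 'I_n).
Hypothesis esym : symmetric e.
Hypothesis edeg : forall u, (\sum_v e u v <= 2)%N.

Local Notation quad := ('I_n * 'I_n * 'I_n * 'I_n)%type.
Implicit Types (q k : quad) (s : 'S_n).
Local Notation disjoint_edges := (disjoint_edges e).

Definition crossings s : R := (crossing_number e s)%:R.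
Local Notation X := crossings.

Definition cross_diff k q s : R :=
  (chords_cross s q)%:R - (chords_cross (swap_mid k * s)%g q)%:R.

Lemma swap_midK k : involutive (fun s => swap_mid k * s)%g.
Proof.
by case: k => [[[a b] c] d] s /=; rewrite mulgA tperm2 mul1g.
Qed.

Lemma cross_diff_swap k q s : cross_diff k q (swap_mid k * s)%g = - cross_diff k q s.
Proof. by rewrite /cross_diff (swap_midK k) opprB. Qed.

Lemma cross_diff_le1 k q s : `|cross_diff k q s| <= 1.
Proof.
rewrite /cross_diff; case: (chords_cross _ _); case: (chords_cross _ _);
  by rewrite ?subrr ?subr0 ?sub0r ?normrN ?normr1 ?normr0 ?ler01.
Qed.

(** With N quadruples, the unswapped indicators sum to 8 X and the swapped ones to (N - 8 X) / 2, so
    the difference is 12 X - N / 2. Its average is 0 by antisymmetry, which identifies N / 2 as 12 E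
    X. *)
Lemma sum_cross_diff s :
  X s - avg X = 12^-1 * \sum_(k | disjoint_edges k) cross_diff k k s.
Proof.
pose N : R := (\sum_(q | disjoint_edges q) 1)%N%:R.
have main t : \sum_(k | disjoint_edges k) cross_diff k k t = 12 * X t - N / 2.
  have := congr1 (fun m : nat => m%:R : R) (sum_chords_cross esym t).
  have := congr1 (fun m : nat => m%:R : R) (sum_chords_cross_swap esym t).
  rewrite natrD !natrM -/N -/(crossings t) !natr_sum sumrB; lra.
have avg0 : avg (fun t => \sum_(k | disjoint_edges k) cross_diff k k t) = 0.
  rewrite avg_sum big1 // => k _; set a := avg _.
  suff : a = - a by lra.
  rewrite {1}/a -(reindex_avg (h := fun s => swap_mid k * s)%g); last exact: mulgI.
  by rewrite -avgN; apply: eq_avg => t; rewrite cross_diff_swap.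
move: avg0; rewrite (eq_avg main) avgB avgZ (avg_cst card_perm_gt0) main; lra.
Qed.

Lemma crossings_swap k s :
  X s - X (swap_mid k * s)%g = 8^-1 * \sum_(q | disjoint_edges q) cross_diff k q s.
Proof.
have h t := congr1 (fun m : nat => m%:R : R) (sum_chords_cross esym t).
move: (h s) (h (swap_mid k * s)%g); rewrite !natrM !natr_sum -!/(crossings _) sumrB.
lra.
Qed.

Let same_order_chords (A : {set 'I_n}) q s s' :
  (forall v, (0 < occ v q)%N -> v \in A) -> same_order A s s' ->
  chords_cross s q = chords_cross s' q.
Proof.
case: q => [[[a b] c] d] /= qA ss'.
have [aA bA cA dA] : [/\ a \in A, b \in A, c \in A & d \in A].
  by split; apply: qA; rewrite eqxx; lia.
by rewrite /alternate !(ss' _ _) .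
Qed.

Lemma order_local_cross_diff k q : meets_mid q k ->
  order_local (support2 (k, q)) (cross_diff k q).
Proof.
move=> mk s s' ss'; rewrite /cross_diff.
have kA v : (0 < occ v k)%N -> v \in support2 (k, q).
  by rewrite inE /= => ->.
have qA v : (0 < occ v q)%N -> v \in support2 (k, q).
  by rewrite inE /= orbC => ->.
rewrite (same_order_chords qA ss'); congr (_ - (nat_of_bool _)%:R).
apply: (same_order_chords qA) => u v uA vA; rewrite !permM; apply: ss';
  case: k kA {mk qA} uA vA => [[[a b] c] d] kA uA vA /=;
  case: tpermP => // _; apply: kA; rewrite /= eqxx; lia.
Qed.

Lemma cross_diff_unlinked k q s : ~~ meets_mid q k -> cross_diff k q s = 0.
Proof.
rewrite /cross_diff; case: k q => [[[a b] c] d] [[[a' b'] c'] d'] /=.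
rewrite negb_or -!leqNgt !leqn0 !addn_eq0 !eqb0 -!andbA.
move=> /and5P[? ? ? ? /and4P[? ? ? ?]].
by rewrite !permM !tpermD// subrr.
Qed.

Section weighted.
Variable phi : R -> R.
Hypothesis phi_le1 : forall x, `|x| <= 1 -> `|phi x| <= 1.

(** Treats both sums of the Stein bound at once: up to the factor [(24 * v)^-1], where v is the
    variance of X, it is S1 when [phi] is the identity and S2 when [phi] is the absolute value. *)
Definition weighted_diff s : R :=
  \sum_(k | disjoint_edges k) phi (cross_diff k k s) * (X s - X (swap_mid k * s)%g).

(** Expanding the change of X over quadruples q leaves a sum over linked pairs with a factor 1/8,
    squared into 64. Each of the n vertices lies in at most 1024 n^2 supports. *)
Lemma covar_weighted_diff : covar weighted_diff weighted_diff <=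
  2 * n%:R * (1024 * n%:R ^+ 2) ^+ 2 / 64.
Proof.
pose h (p : quad * quad) s := phi (cross_diff p.1 p.1 s) * cross_diff p.1 p.2 s.
have wE s : weighted_diff s = 8^-1 * \sum_(p | linked e p) h p s.
  rewrite /weighted_diff.
  under eq_bigr => k _ do rewrite crossings_swap mulrCA mulr_sumr.
  rewrite -mulr_sumr pair_big; congr (_ * _).
  rewrite big_mkcond [RHS]big_mkcond; apply: eq_bigr => -[k q] _.
  rewrite /linked /h /=; case: (disjoint_edges k) => //=.
  case: (disjoint_edges q) => //=; case: ifPn => // /cross_diff_unlinked ->.
  by rewrite mulr0.
rewrite (eq_covar wE wE) covarZl covarC covarZl.
have hl p : linked e p -> order_local (support2 p) (h p).
  case: p => k q /and3P[_ _ /= m] s s' ss'; rewrite /h /=.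
  rewrite (order_local_cross_diff m ss'); congr (phi _ * _).
  apply: (@order_local_cross_diff k k) => [|u v uA vA].
    by case: (k) => [[[a b] c] d] /=; rewrite eqxx; lia.
  by apply: ss'; move: uA vA; rewrite !inE /= !orbb => uA vA; rewrite ?uA ?vA.
have h1 p s : linked e p -> `|h p s| <= 1.
  move=> _; rewrite normrM mulr_ile1// ?phi_le1 ?cross_diff_le1//.
have /= := covar_sum_order_local hl h1.
set V := covar _ _; set B := \sum_v _ => VB.
have count v : \sum_(p | linked e p) (v \in support2 p)%:R <= 1024 * n%:R ^+ 2 :> R.
  have := count_support2 esym edeg v.
  by rewrite -(ler_nat R) natr_sum natrM natrX.
have M0 : 0 <= 1024 * n%:R ^+ 2 :> R.
  exact: mulr_ge0 (ler0n _ _) (exprn_ge0 _ (ler0n _ _)).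
move: count M0; move: (1024 * _) => M count M0.
have BB : B <= n%:R * M ^+ 2.
  apply: (@le_trans _ _ (\sum_(v : 'I_n) M ^+ 2)); last first.
    by rewrite sumr_const card_ord -[leLHS]mulr_natl lexx.
  by apply: ler_sum => v _; rewrite ler_sqr ?nnegrE ?sumr_ge0.
lra.
Qed.

End weighted.

(** The deviations of S1 from its mean 1 and of S2 from its mean 0 have the same L^2 bound, weighted
    1 and 4; hence 5. The denominator is 192 = 24 * 8, with 8 the square root of 64. *)
Theorem kolmogorov_crossings z : 0 < covar X X ->
  `|avg (fun s => ((X s - avg X) / Num.sqrt (covar X X) <= z)%R%:R) - ncdf z| <=
  5 * Num.sqrt (2 * n%:R * (1024 * n%:R ^+ 2) ^+ 2) / (192 * covar X X).
Proof.
move=> v0; set v := covar X X; pose sg := Num.sqrt v.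
have sg0 : 0 < sg by rewrite sqrtr_gt0.
have sgv : sg ^+ 2 = v by rewrite sqr_sqrtr// ltW.
pose W s := (X s - avg X) / sg; pose c := (12 * sg)^-1.
have c0 : 0 <= c by rewrite invr_ge0 mulr_ge0// ltW.
have WD s : W s = c * \sum_(k | disjoint_edges k) cross_diff k k s.
  rewrite /W sum_cross_diff /c invfM; ring.
have Dt k s := cross_diff_swap k k s.
have sdiff phi s : c / 2 * \sum_(k | disjoint_edges k)
    phi (cross_diff k k s) * (W s - W (swap_mid k * s)%g) =
    (24 * v)^-1 * weighted_diff phi s.
  rewrite /weighted_diff -sgv !mulr_sumr; apply: eq_bigr => k _.
  by rewrite /W /c; field; rewrite gt_eqF.
pose T1 s := (24 * v)^-1 * weighted_diff id s.
pose T2 s := (24 * v)^-1 * weighted_diff Num.norm s.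
have avgW2 : avg (fun s => W s ^+ 2) = 1.
  rewrite (eq_avg (g := fun s => v^-1 * (X s - avg X) ^+ 2)).
    by rewrite avgZ -(covar_center card_perm_gt0) -/v mulVf// gt_eqF.
  by move=> s; rewrite /W exprMn exprVn sgv mulrC.
have avgT1 : avg T1 = 1.
  rewrite -avgW2 -(avg_S1 swap_midK Dt WD).
  by apply: eq_avg => s; rewrite (sdiff id).
have avgT2 : avg T2 = 0.
  rewrite -(avg_S2 card_perm_gt0 disjoint_edges W c swap_midK Dt).
  by apply: eq_avg => s; rewrite (sdiff Num.norm).
have cw := covar_weighted_diff.
have B0 : 0 <= 2 * n%:R * (1024 * n%:R ^+ 2) ^+ 2 :> R.
  exact: mulr_ge0 (mulr_ge0 (ler0n _ _) (ler0n _ _)) (sqr_ge0 _).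
move: cw B0; move: (2 * n%:R * _ ^+ 2) => B cw B0.
have small phi (T := fun s => (24 * v)^-1 * weighted_diff phi s) :
    (forall x, `|x| <= 1 -> `|phi x| <= 1) ->
    avg (fun s => `|avg T - T s|) <= Num.sqrt B / (192 * v).
  move=> phi1.
  have -> : Num.sqrt B / (192 * v) = Num.sqrt (B / (192 * v) ^+ 2).
    have : 0 < 192 * v by rewrite pmulr_rgt0// ltr0n.
    by move: (192 * v) => d d0; rewrite sqrtrM// sqrtrV ?sqr_ge0// sqrtr_sqr gtr0_norm.
  apply: (avg_norm_le_sqrt card_perm_gt0).
  rewrite (eq_avg (g := fun s => (T s - avg T) ^+ 2)); last by move=> s; ring.
  rewrite -(covar_center card_perm_gt0) /T covarZl covarC covarZl.
  have h := cw _ phi1.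
  apply: (@le_trans _ _ ((24 * v)^-1 * ((24 * v)^-1 * (B / 64)))).
    by rewrite !ler_wpM2l// invr_ge0 mulr_ge0// ltW.
  by rewrite le_eqVlt; apply/orP; left; apply/eqP; field; rewrite gt_eqF.
have h1 : avg (fun s => `|1 - T1 s|) <= Num.sqrt B / (192 * v).
  rewrite (eq_avg (g := fun s => `|avg T1 - T1 s|)); last by move=> s; rewrite avgT1.
  exact: (small id (fun x h => h)).
have h2 : avg (fun s => `|T2 s|) <= Num.sqrt B / (192 * v).
  rewrite (eq_avg (g := fun s => `|avg T2 - T2 s|)); last first.
    by move=> s; rewrite avgT2 sub0r normrN.
  by apply: (small Num.norm) => x; rewrite normr_id.
apply: le_trans (stein_exchangeable_bound card_perm_gt0 swap_midK Dt c0 WD z) _.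
rewrite -mulrA; set Y := _ / _ in h1 h2 *.
rewrite (_ : 5 * Y = Y + 4 * Y); last by ring.
apply: lerD.
  by apply: le_trans h1; apply: ler_avg => s /=; rewrite (sdiff id).
apply: ler_wpM2l => //.
by apply: le_trans h2; apply: ler_avg => s /=; rewrite (sdiff Num.norm).
Qed.

End kolmogorov_bound.

(** * The variance for the path *)

(* One-line notations of the permutations of 0, ..., m - 1, built by choosing the
   last value j and renumbering the other ones around it. *)
Fixpoint one_lines (m : nat) : seq (seq nat) :=
  if m is m'.+1 then
    [seq rcons (map (bump j) p) j | j <- iota 0 m'.+1, p <- one_lines m']
  else [:: [::]].

Definition one_line n (s : 'S_n) : seq nat := [seq val (s i) | i <- enum 'I_n].

Lemma size_one_line n (s : 'S_n) : size (one_line s) = n.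
Proof. by rewrite size_map size_enum_ord. Qed.

Lemma sum_lift_perm (M : nmodType) n (h : 'S_n.+1 -> M) :
  \sum_s h s = \sum_(j < n.+1) \sum_(s : 'S_n) h (lift_perm ord_max j s).
Proof.
rewrite pair_big /= (reindex (fun p : 'I_n.+1 * 'S_n => lift_perm ord_max p.1 p.2))//.
apply: onW_bij; apply: inj_card_bij => [[j s] [j' s'] /= eq|]; last first.
  by rewrite card_prod !card_Sn card_ord factS.
have jj : j = j' by rewrite -(lift_perm_id ord_max j s) eq lift_perm_id.
subst j'; congr (_, _); apply/permP => k.
have := congr1 (fun t : 'S_n.+1 => t (lift ord_max k)) eq.
by rewrite !lift_perm_lift => /lift_inj.
Qed.

Lemma one_line_lift_perm n (j : 'I_n.+1) (s : 'S_n) :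
  one_line (lift_perm ord_max j s) = rcons (map (bump j) (one_line s)) j.
Proof.
rewrite /one_line enum_ordSr map_rcons lift_perm_id -!map_comp; congr rcons.
apply: eq_map => i /=; rewrite (_ : widen_ord _ i = lift ord_max i).
  by rewrite lift_perm_lift.
by apply: val_inj; rewrite /= /bump leqNgt ltn_ord.
Qed.

Lemma sum_one_line (M : nmodType) n (G : seq nat -> M) :
  \sum_(s : 'S_n) G (one_line s) = \sum_(p <- one_lines n) G p.
Proof.
elim: n G => [|n IH] G.
  rewrite (big_pred1 1%g); last first.
    by move=> s; symmetry; apply/eqP/permP => -[].
  rewrite big_seq1; congr G; apply/size0nil; exact: size_one_line.
rewrite sum_lift_perm big_allpairs_dep -[iota 0 _]/(index_iota 0 n.+1) big_mkord.
apply: eq_bigr => j _; rewrite -(IH (fun p => G (rcons (map (bump j) p) j))).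
by apply: eq_bigr => s _; rewrite one_line_lift_perm.
Qed.

Section pattern.
Context {R : realType}.

(** Inserting the value j in a one-line notation renumbers the others by [bump j]; functions of the
    relative order do not see it. *)
Definition bump_invariant m (G : seq nat -> R) :=
  forall j p, size p = m -> G (map (bump j) p) = G p.

(** An additional last place only renumbers the first m values, so all its possible values
    contribute equally. *)
Lemma avg_take_one_line m n (G : seq nat -> R) : bump_invariant m G ->
  avg (fun s : 'S_(m + n) => G (take m (one_line s))) =
  (\sum_(p <- one_lines m) G p) / m`!%:R.
Proof.
move=> Gb; elim: n => [|n IH].
  rewrite addn0 /avg card_Sn; congr (_ / _).
  rewrite -(sum_one_line m G); apply: eq_bigr => s _.
  by rewrite take_oversize// size_one_line.
rewrite addnS -IH /avg sum_lift_perm !card_Sn factS.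
rewrite (eq_bigr (fun=> \sum_(s : 'S_(m + n)) G (take m (one_line s)))).
  rewrite sumr_const card_ord natrM -[_ *+ (m + n).+1]mulr_natl.
  by rewrite invfM mulrACA mulfV ?mul1r// pnatr_eq0.
move=> j _; apply: eq_bigr => s _.
have sm : (m <= size (one_line s))%N by rewrite size_one_line leq_addr.
rewrite one_line_lift_perm -cats1 takel_cat; last by rewrite size_map.
by rewrite -map_take Gb// size_takel.
Qed.

Lemma perm_extending n (l : seq 'I_n) : uniq l ->
  exists r : 'S_n, take (size l) [seq r i | i <- enum 'I_n] = l.
Proof.
move=> ul; pose l' := l ++ [seq x <- enum 'I_n | x \notin l].
have ul' : uniq l'.
  rewrite cat_uniq ul filter_uniq ?enum_uniq// andbT.
  by apply/hasPn => x; rewrite mem_filter => /andP[].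
have ml' x : x \in l'.
  by rewrite mem_cat mem_filter mem_enum andbT; case: (x \in l).
have sl' : size l' = n.
  rewrite -[RHS](card_ord n) -(card_uniqP ul'); apply: eq_card => x.
  by rewrite ml'.
have rinj : injective (fun i : 'I_n => nth i l' i).
  move=> i j /=; rewrite (set_nth_default j) ?sl'//.
  by move/eqP; rewrite nth_uniq ?sl'// => /eqP/val_inj.
exists (perm rinj).
suff -> : [seq perm rinj i | i <- enum 'I_n] = l' by rewrite take_size_cat.
case: n l ul l' ul' ml' sl' rinj => [|n] l ul l' ul' ml' sl' rinj.
  have nil0 (t : seq 'I_0) : t = [::] by case: t => // -[].
  by rewrite [LHS]nil0 [RHS]nil0.
apply: (@eq_from_nth _ ord0); first by rewrite size_map size_enum_ord sl'.
move=> i; rewrite size_map size_enum_ord => ilt.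
rewrite (nth_map ord0) ?size_enum_ord// permE (nth_ord_enum ord0 (Ordinal ilt)) /=.
by rewrite (set_nth_default ord0)// sl'.
Qed.

(** A relabelling moves [l] to the first places. This turns an average over permutations of
    arbitrary size into an enumeration that can be evaluated. *)
Lemma avg_pattern n (l : seq 'I_n) (G : seq nat -> R) :
  uniq l -> bump_invariant (size l) G ->
  avg (fun s : 'S_n => G [seq val (s i) | i <- l]) =
  (\sum_(p <- one_lines (size l)) G p) / (size l)`!%:R.
Proof.
move=> ul Gb; have [r rl] := perm_extending ul.
have ln : (size l <= n)%N by rewrite -[leqRHS](card_ord n) -(card_uniqP ul) max_card.
rewrite -(avg_take_one_line (n - size l) Gb) subnKC//.
rewrite -[RHS](reindex_avg (h := fun s => r * s)%g); last exact: mulgI.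
apply: eq_avg => s; congr G.
rewrite /one_line -map_take -{1}rl -map_take -map_comp.
by apply: eq_map => i /=; rewrite permM.
Qed.

End pattern.

Lemma ltn_bump2 h i j : (bump h i < bump h j)%N = (i < j)%N.
Proof. by rewrite !ltnNge leq_bump2. Qed.

Lemma alternate_bump h x y z w :
  alternate (bump h x) (bump h y) (bump h z) (bump h w) = alternate x y z w.
Proof. by rewrite /alternate !ltn_bump2. Qed.

Lemma alternate_swapl x y z w : alternate y x z w = alternate x y z w.
Proof. by rewrite /alternate orbC [X in _ (+) X]orbC. Qed.

Lemma alternate_swapr x y z w : alternate x y w z = alternate x y z w.
Proof. exact: addbC. Qed.

Lemma alternate_swap x y z w : uniq [:: x; y; z; w] ->
  alternate z w x y = alternate x y z w.
Proof.
rewrite /alternate /= !inE !negb_or -!andbA.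
move=> /and5P[xy xz xw yz /and3P[yw zw _]]; lia.
Qed.

(** * Covariances of crossing indicators of path edges *)

Section edge_crossings.
Context {R : realType} {n : nat}.
Implicit Types (s : 'S_n.+1) (i j k l v : nat).

(** Vertices are plain numbers so that [i.+1] and [i.+2] can be written freely. Numbers above n are
    sent to 0 by [inord], which is why [valid] also bounds them. *)
Definition place s v : nat := s (inord v).

Let valid (vs : seq nat) := all (fun v => v <= n)%N vs && uniq vs.

Let validP vs : valid vs -> uniq [seq inord v : 'I_n.+1 | v <- vs].
Proof.
move=> /andP[/allP vn u]; rewrite map_inj_in_uniq// => v w /vn vn' /vn wn'.
by move/(congr1 val); rewrite /= !inordK.
Qed.

Let place_map s vs : [seq place s v | v <- vs] =
  [seq val (s u) | u <- [seq inord v : 'I_n.+1 | v <- vs]].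
Proof. by rewrite -map_comp. Qed.

Let valid_place s vs : valid vs -> uniq [seq place s v | v <- vs].
Proof.
by move=> /validP u; rewrite place_map map_inj_uniq// => x y /val_inj/perm_inj.
Qed.

Definition alternate_at (p : seq nat) (I : nat * nat * nat * nat) : bool :=
  let: (a, b, c, d) := I in
  alternate (nth 0%N p a) (nth 0%N p b) (nth 0%N p c) (nth 0%N p d).

Definition below m (I : nat * nat * nat * nat) : bool :=
  let: (a, b, c, d) := I in [&& a < m, b < m, c < m & d < m]%N.

Lemma alternate_at_bump m I h p : below m I -> size p = m ->
  alternate_at (map (bump h) p) I = alternate_at p I.
Proof.
case: I => [[[a b] c] d] /and4P[am bm cm dm] sp /=.
by rewrite !(nth_map 0%N) ?sp// alternate_bump.
Qed.

Lemma avg_place vs (f : seq nat -> bool) : valid vs ->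
  (forall h p, size p = size vs -> f (map (bump h) p) = f p) ->
  avg (fun s => (f [seq place s v | v <- vs])%:R : R) =
  (count f (one_lines (size vs)))%:R / (size vs)`!%:R.
Proof.
move=> vv fb; pose G p : R := (f p)%:R.
have Gb : bump_invariant (size [seq inord v : 'I_n.+1 | v <- vs]) G.
  by move=> h p; rewrite size_map => sp; rewrite /G fb.
have := avg_pattern (validP vv) Gb; rewrite size_map => h.
rewrite (eq_avg (g := fun s => G [seq val (s u) | u <- [seq inord v : 'I_n.+1 | v <- vs]])).
  rewrite h; congr (_ / _); rewrite -sum1_count natr_sum [RHS]big_mkcond /=.
  by apply: eq_bigr => p _; rewrite /G; case: (f p).
by move=> s; rewrite -place_map.
Qed.

(** Passing the counts as variables lets numerals be supplied; the hypotheses then hold by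
    evaluating [one_lines], at most 720 patterns below. *)
Lemma covar_place vs I J N N1 N2 M : valid vs ->
  below (size vs) I -> below (size vs) J ->
  count (fun p => alternate_at p I && alternate_at p J) (one_lines (size vs)) = N ->
  count (alternate_at^~ I) (one_lines (size vs)) = N1 ->
  count (alternate_at^~ J) (one_lines (size vs)) = N2 -> (size vs)`! = M ->
  covar (fun s => (alternate_at [seq place s v | v <- vs] I)%:R : R)
        (fun s => (alternate_at [seq place s v | v <- vs] J)%:R) =
  N%:R / M%:R - (N1%:R / M%:R) * (N2%:R / M%:R).
Proof.
move=> vv bI bJ <- <- <- <-; rewrite /covar.
rewrite -(avg_place (f := alternate_at^~ I) vv (fun h p sp => alternate_at_bump h bI sp)).
rewrite -(avg_place (f := alternate_at^~ J) vv (fun h p sp => alternate_at_bump h bJ sp)).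
rewrite -(avg_place (f := fun p => alternate_at p I && alternate_at p J) vv); last first.
  by move=> h p sp; rewrite (alternate_at_bump _ bI sp) (alternate_at_bump _ bJ sp).
congr (_ - _); apply: eq_avg => s.
by rewrite -natrM mulnb.
Qed.

Definition edge_cross i j s : R :=
  (alternate (place s i) (place s i.+1) (place s j) (place s j.+1))%:R.
Local Notation c := edge_cross.

Lemma edge_crossC i j : valid [:: i; i.+1; j; j.+1] -> c i j =1 c j i.
Proof. by move=> v s; rewrite /c -alternate_swap//; exact: (valid_place s v). Qed.

(** This and the next six lemmas give the nonzero covariances. Every indicator has mean 1/3, so each
    value is the probability of both crossings minus 1/9. *)
Lemma covar_same_edges i j : valid [:: i; i.+1; j; j.+1] ->
  covar (c i j) (c i j) = 2 / 9.
Proof.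
move=> v; rewrite (covar_place (I := (0, 1, 2, 3)%N) (J := (0, 1, 2, 3)%N)
  (N := 8) (N1 := 8) (N2 := 8) (M := 24) v) //; lra.
Qed.

Lemma covar_adjacent_edges i j : valid [:: i; i.+1; i.+2; j; j.+1] ->
  covar (c i j) (c i.+1 j) = 1 / 18.
Proof.
move=> v; rewrite (covar_place (I := (0, 1, 3, 4)%N) (J := (1, 2, 3, 4)%N)
  (N := 20) (N1 := 40) (N2 := 40) (M := 120) v) //; lra.
Qed.

Lemma covar_shared_edge i k j : valid [:: i; i.+1; k; k.+1; j; j.+1] ->
  covar (c i j) (c k j) = 1 / 45.
Proof.
move=> v; rewrite (covar_place (I := (0, 1, 4, 5)%N) (J := (2, 3, 4, 5)%N)
  (N := 96) (N1 := 240) (N2 := 240) (M := 720) v) //; lra.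
Qed.

Lemma covar_parallel_edges i l : valid [:: i; i.+1; i.+2; l; l.+1; l.+2] ->
  covar (c i l) (c i.+1 l.+1) = 1 / 180.
Proof.
move=> v; rewrite (covar_place (I := (0, 1, 3, 4)%N) (J := (1, 2, 4, 5)%N)
  (N := 84) (N1 := 240) (N2 := 240) (M := 720) v) //; lra.
Qed.

Lemma covar_antiparallel_edges i l : valid [:: i; i.+1; i.+2; l; l.+1; l.+2] ->
  covar (c i.+1 l) (c i l.+1) = 1 / 180.
Proof.
move=> v; rewrite (covar_place (I := (1, 2, 3, 4)%N) (J := (0, 1, 4, 5)%N)
  (N := 84) (N1 := 240) (N2 := 240) (M := 720) v) //; lra.
Qed.

Lemma covar_bridging_edge i j : valid [:: i; i.+1; i.+2; i.+3; j; j.+1] ->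
  covar (c i i.+2) (c i.+1 j) = - (1 / 90).
Proof.
move=> v; rewrite (covar_place (I := (0, 1, 2, 3)%N) (J := (1, 2, 4, 5)%N)
  (N := 72) (N1 := 240) (N2 := 240) (M := 720) v) //; lra.
Qed.

Lemma covar_zigzag_edges i : valid [:: i; i.+1; i.+2; i.+3; i.+4] ->
  covar (c i i.+2) (c i.+1 i.+3) = - (1 / 36).
Proof.
move=> v; rewrite (covar_place (I := (0, 1, 2, 3)%N) (J := (1, 2, 3, 4)%N)
  (N := 10) (N1 := 40) (N2 := 40) (M := 120) v) //; lra.
Qed.

(* Averaging over the three matchings of a, b, c, d makes the first factor
   constant, while swaps among b, c', d leave the second one unchanged. *)
Lemma covar_untouched_edges a b c' d i l : valid [:: a; b; c'; d] ->
  (i.+1 <= n)%N -> (l.+1 <= n)%N ->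
  ~~ has (mem [:: i; i.+1; l; l.+1]) [:: b; c'; d] ->
  covar (fun s => (alternate (place s a) (place s b) (place s c') (place s d))%:R)
    (c i l) = 0.
Proof.
move=> v i_n l_n /hasPn nh; set A := fun s => _.
have [vn _] := andP v.
have vbn u : u \in [:: a; b; c'; d] -> (u < n.+1)%N by move/(allP vn).
have pT x y u s : u \in [:: a; b; c'; d; i; i.+1; l; l.+1] ->
    x \in [:: b; c'; d] -> y \in [:: b; c'; d] -> u != x -> u != y ->
    place (tperm (inord x) (inord y) * s)%g u = place s u.
  move=> uI xI yI ux uy; rewrite /place permM.
  have un : (u < n.+1)%N.
    move: uI; rewrite (mem_cat u [:: a; b; c'; d]) => /orP[/vbn//|].
    by rewrite !inE => /or4P[] /eqP ->; lia.
  have xn : (x < n.+1)%N by apply: vbn; rewrite inE xI orbT.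
  have yn : (y < n.+1)%N by apply: vbn; rewrite inE yI orbT.
  rewrite tpermD// -(inj_eq val_inj) /= !inordK// eq_sym//.
have pL x y s : place (tperm (inord x) (inord y) * s)%g x = place s y.
  by rewrite /place permM tpermL.
have pR x y s : place (tperm (inord x) (inord y) * s)%g y = place s x.
  by rewrite /place permM tpermR.
have inv x y : x \in [:: b; c'; d] -> y \in [:: b; c'; d] ->
    forall s, c i l (tperm (inord x) (inord y) * s)%g = c i l s.
  move=> xI yI s; have := nh _ xI; have := nh _ yI; rewrite /= !inE !negb_or.
  move=> /and4P[y1 y2 y3 y4] /and4P[x1 x2 x3 x4].
  by rewrite /c !pT ?(eq_sym _ x) ?(eq_sym _ y)// !inE eqxx ?orbT.
have [/= ab ac ad [bc bd cd]] : [/\ a != b, a != c', a != d & [/\ b != c', b != d & c' != d]].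
  move: v => /andP[_ /=]; rewrite !inE !negb_or -!andbA.
  by move=> /and5P[-> -> -> -> /and3P[-> -> _]].
have mems : [/\ b \in [:: b; c'; d], c' \in [:: b; c'; d] & d \in [:: b; c'; d]].
  by split; rewrite !inE eqxx ?orbT.
have [bI cI dI] := mems.
pose A1 s := A (tperm (inord b) (inord c') * s)%g.
pose A2 s := A (tperm (inord b) (inord d) * s)%g.
have AE s : A s + A1 s + A2 s = 1.
  rewrite /A1 /A2 /A !pL !pR.
  rewrite !pT ?inE ?eqxx ?orbT// 1?eq_sym// -!natrD.
  by rewrite alternate_matchings//; exact: (valid_place s v).
have key g : (forall s, g (tperm (inord b) (inord c') * s)%g = g s) ->
    (forall s, g (tperm (inord b) (inord d) * s)%g = g s) ->
    avg (fun s => A s * g s) = avg g / 3.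
  move=> g1 g2.
  have e1 : avg (fun s => A1 s * g s) = avg (fun s => A s * g s).
    rewrite -[RHS](reindex_avg (h := fun s => tperm (inord b) (inord c') * s)%g); last exact: mulgI.
    by apply: eq_avg => s; rewrite g1.
  have e2 : avg (fun s => A2 s * g s) = avg (fun s => A s * g s).
    rewrite -[RHS](reindex_avg (h := fun s => tperm (inord b) (inord d) * s)%g); last exact: mulgI.
    by apply: eq_avg => s; rewrite g2.
  have : avg g = avg (fun s => A s * g s + A1 s * g s + A2 s * g s).
    by apply: eq_avg => s; rewrite -!mulrDl AE mul1r.
  by rewrite !avgD e1 e2 => ->; field.
have k1 := key _ (inv _ _ bI cI) (inv _ _ bI dI).
have k2 := key (fun=> 1) (fun _ => erefl) (fun _ => erefl).
rewrite /covar k1; move: k2; rewrite (avg_cst card_perm_gt0).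
rewrite (eq_avg (g := A)) => [->|s]; last by rewrite mulr1.
by field.
Qed.

End edge_crossings.

Section tridiagonal_sums.
Context {R : realType}.
Implicit Types (x y z : R) (i k m : nat).

(** Edges i and k of a path enter a covariance through |i - k| being 0, 1 or larger; [z] need not be
    0. *)
Definition tridiagonal x y z i k : R :=
  if i == k then x else if (i == k.+1) || (k == i.+1) then y else z.

Let tridiagonal_last m x y z (f : nat -> nat -> R) :
  (forall i, f i m.+1 = tridiagonal x y z i m.+1) ->
  \sum_(i < m.+1) f i m.+1 = y + m%:R * z.
Proof.
move=> fE; rewrite big_ord_recr /= addrC; congr (_ + _).
  by rewrite fE /tridiagonal ltn_eqF//= eqxx orbT.
rewrite (eq_bigr (fun=> z)) => [|i _]; last first.
  rewrite fE /tridiagonal; have := ltn_ord i; case: i => i /= _ im.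
  by rewrite ifF ?ifF//; apply/negP; lia.
by rewrite sumr_const card_ord -[LHS]mulr_natl.
Qed.

Lemma sum_tridiagonal m x y z :
  \sum_(i < m.+1) \sum_(k < m.+1) tridiagonal x y z i k =
  m.+1%:R * x + 2 * m%:R * y + m%:R * (m%:R - 1) * z.
Proof.
elim: m => [|m IH].
  by rewrite !big_ord_recr !big_ord0 /= /tridiagonal eqxx; ring.
rewrite big_ord_recr /=.
under eq_bigr => i _ do rewrite big_ord_recr /=.
rewrite big_split /= IH (tridiagonal_last (x := x) (y := y) (z := z))//.
rewrite big_ord_recr /= (eq_bigr (fun i : 'I_m.+1 => tridiagonal x y z i m.+1)); last first.
  by move=> i _; rewrite /tridiagonal eq_sym orbC.
rewrite (tridiagonal_last (x := x) (y := y) (z := z))// /tridiagonal eqxx.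
by rewrite -[m.+2%:R]natr1 -[m.+1%:R]natr1; ring.
Qed.

Lemma sum_indicator m a x : (a < m)%N -> \sum_(k < m) (k == a :> nat)%:R * x = x.
Proof.
move=> am; rewrite (bigD1 (Ordinal am))//= eqxx mul1r big1 ?addr0// => k.
by rewrite -(inj_eq val_inj) /= => /negPf ->; rewrite mul0r.
Qed.

End tridiagonal_sums.

(** * Adding the edges of the path one at a time *)

Section path_variance.
Context {R : realType} {n : nat}.
Implicit Types (s : 'S_n.+1) (i j k l m N : nat).

Local Notation c := (@edge_cross R n).

(** Edge j shares a vertex with edge j - 1, so only the earlier edges below [j.-1] can cross it; the
    sum is empty for j < 2. *)
Definition new_crossings j s : R := \sum_(i < j.-1) c i j s.
Local Notation Y := new_crossings.

Lemma covar_new_crossings l j : covar (Y l) (Y j) =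
  \sum_(i < l.-1) \sum_(k < j.-1) covar (c i l) (c k j).
Proof.
rewrite covar_suml; apply: eq_bigr => i _.
by rewrite covar_sumr.
Qed.

Lemma var_new_crossings m : (m.+2 < n)%N -> covar (Y m.+2) (Y m.+2) =
  m.+1%:R * (2 / 9) + 2 * m%:R * (1 / 18) + m%:R * (m%:R - 1) * (1 / 45).
Proof.
move=> mn; rewrite covar_new_crossings -sum_tridiagonal.
apply: eq_bigr => -[i /= im] _; apply: eq_bigr => -[k /= km] _.
rewrite /tridiagonal; case: eqVneq => [<-|ik].
  by rewrite covar_same_edges//=; rewrite ?inE; lia.
case: eqVneq => [e|ik1] /=.
  by subst i; rewrite covarC covar_adjacent_edges//=; rewrite ?inE; lia.
case: eqVneq => [e|ki1] /=.
  by subst k; rewrite covar_adjacent_edges//=; rewrite ?inE; lia.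
by rewrite covar_shared_edge//=; rewrite ?inE; lia.
Qed.

(** For each of the l + 1 values of i, the choices k = i and k = l + 2 share an edge and give 1/45
    each. The choice k = i + 1 matters only for i = l, where it bridges the edges l and l + 2 and
    gives - 1/90. *)
Lemma covar_new_crossings_far l j : (l.+3 < j)%N -> (j < n)%N ->
  covar (Y l.+2) (Y j) = 2 * l.+1%:R / 45 - 1 / 90.
Proof.
move=> lj jn; rewrite covar_new_crossings /=.
rewrite (eq_bigr (fun i : 'I_l.+1 => 2 / 45 - (i == l :> nat)%:R * (1 / 90))).
  rewrite sumrB sum_indicator// sumr_const card_ord -[_ *+ l.+1]mulr_natl.
  by congr (_ - _); ring.
move=> [i /= il] _.
rewrite (eq_bigr (fun k : 'I_j.-1 => (k == i :> nat)%:R * (1 / 45) +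
    (k == l.+2 :> nat)%:R * (1 / 45) - (k == i.+1 :> nat)%:R * ((i == l)%:R * (1 / 90)))).
  rewrite sumrB big_split /= !sum_indicator; try lia.
  by congr (_ - _); lra.
move=> [k /= kj] _.
have [e|ki] := eqVneq k i.
  subst k; rewrite (eq_covar (edge_crossC _) (edge_crossC _)); try by rewrite /= ?inE; lia.
  rewrite covar_shared_edge; last by rewrite /= ?inE; lia.
  have [e1 e2] : (i == l.+2) = false /\ (i == i.+1) = false by lia.
  by rewrite ?eqxx e1 e2 mulr1n !mulr0n !mul0r !mul1r subr0 addr0.
have [e|kl] := eqVneq k l.+2.
  subst k; rewrite (eq_covar (f' := c i l.+2) (g' := c j l.+2))//; last first.
    by apply: edge_crossC; rewrite /= ?inE; lia.
  rewrite covar_shared_edge; last by rewrite /= ?inE; lia.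
  have [e1 e2] : (l.+2 == i) = false /\ (l.+2 == i.+1) = false by lia.
  by rewrite ?eqxx ?e1 e2 mulr1n !mulr0n !mul0r !mul1r subr0 add0r.
have [e|ki1] := eqVneq k i.+1; last first.
  rewrite !mulr0n !mul0r subr0 addr0.
  (* [covar_untouched_edges] allows only the first of its four vertices to be shared, so edge k is
     oriented to start at the end that may be shared. *)
  case: (boolP (k \in [:: i.+1; l.+3])) => kin.
    rewrite covarC; apply: (@covar_untouched_edges R n k k.+1 j j.+1);
      move: kin; rewrite /= ?inE; lia.
  rewrite (eq_covar (f' := c i l.+2) (g' := fun s =>
    (alternate (place s k.+1) (place s k) (place s j) (place s j.+1))%:R))//; last first.
    by move=> s; rewrite alternate_swapl.
  rewrite covarC; apply: covar_untouched_edges;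
    move: kin; rewrite /= ?inE; lia.
subst k; rewrite !mulr0n mulr1n !mul0r add0r !mul1r; have [e|il2] := eqVneq i l.
  subst i; rewrite covar_bridging_edge; last by rewrite /= ?inE; lia.
  by rewrite mulr1n !mul1r sub0r.
rewrite mulr0n mul0r subr0 covarC; apply: covar_untouched_edges; rewrite /= ?inE; lia.
Qed.

(** The column k = m + 1 is special: edge m + 2 bridges m + 1 and m + 3, giving - 1/90, or - 1/36
    when i = m. Its m terms - 1/90 cancel the 2 m terms 1/180 of the other columns. *)
Lemma covar_new_crossings_near m : (m.+3 < n)%N ->
  covar (Y m.+2) (Y m.+3) = m.+1%:R * (1 / 18) - 1 / 36.
Proof.
move=> mn; rewrite covar_new_crossings /=.
rewrite (eq_bigr (fun i : 'I_m.+1 =>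
    \sum_(k < m.+1) tridiagonal (1 / 18) (1 / 180) 0 i k -
    (if i == m :> nat then 1 / 36 else 1 / 90 : R))).
  rewrite sumrB sum_tridiagonal big_ord_recr /= eqxx.
  rewrite (eq_bigr (fun=> 1 / 90)) => [|[i /= im] _]; last by rewrite ltn_eqF.
  by rewrite sumr_const card_ord -[_ *+ m]mulr_natl -[m.+1%:R]natr1; lra.
move=> [i /= im] _; rewrite big_ord_recr /=; congr (_ + _).
  apply: eq_bigr => -[k /= km] _; rewrite /tridiagonal.
  case: eqVneq => [e|ik].
    subst k; rewrite (eq_covar (edge_crossC _) (edge_crossC _)); try by rewrite /= ?inE; lia.
    by apply: covar_adjacent_edges; rewrite /= ?inE; lia.
  case: eqVneq => [e|ik1] /=.
    by subst i; apply: covar_antiparallel_edges; rewrite /= ?inE; lia.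
  case: eqVneq => [e|ki1] /=.
    by subst k; apply: covar_parallel_edges; rewrite /= ?inE; lia.
  rewrite (eq_covar (f' := c i m.+2) (g' := fun s =>
    (alternate (place s m.+3) (place s m.+4) (place s k) (place s k.+1))%:R))//; last first.
    by apply: edge_crossC; rewrite /= ?inE; lia.
  rewrite covarC; apply: covar_untouched_edges; rewrite /= ?inE; lia.
have [e|im'] := eqVneq i m.
  by subst i; apply: covar_zigzag_edges; rewrite /= ?inE; lia.
rewrite (eq_covar (f' := c m.+2 i) (g' := c m.+1 m.+3))//; last first.
  by apply: edge_crossC; rewrite /= ?inE; lia.
by rewrite covarC; apply: covar_bridging_edge; rewrite /= ?inE; lia.
Qed.

(** The polynomial is right only from four vertices on, where a single pair of edges gives 2/9. With
    two or three vertices no crossing exists, yet the polynomial does not vanish. *)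
Lemma var_sum_new_crossings N : (N.+3 <= n)%N ->
  let X s := \sum_(j < N.+3) Y j s in
  covar X X = N.+4%:R ^+ 3 / 45 - N.+4%:R ^+ 2 / 18 - 11 * N.+4%:R / 45 + 2 / 3.
Proof.
have Y0 j s : (j < 2)%N -> Y j s = 0.
  by case: j => [|[|]]// _; rewrite /Y big_ord0.
elim: N => [|N IH] Nn /=.
  have X3 s : \sum_(j < 3) Y j s = Y 2 s.
    by rewrite 3!big_ord_recr big_ord0 /= (Y0 0%N s)// (Y0 1%N s)// !add0r.
  by rewrite (eq_covar X3 X3) var_new_crossings//; lra.
pose X' s := \sum_(j < N.+3) Y j s.
have XE s : \sum_(j < N.+4) Y j s = X' s + Y N.+3 s by rewrite big_ord_recr.
rewrite (eq_covar XE XE) covarDl covarC [X in _ + X]covarC !covarDl.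
rewrite (covarC (Y N.+3) X') var_new_crossings// IH; last exact: ltnW.
have -> : covar X' (Y N.+3) =
    N%:R * (N%:R + 1) / 45 - N%:R / 90 + N.+1%:R * (1 / 18) - 1 / 36.
  rewrite covar_suml big_ord_recr /= covar_new_crossings_near// addrA.
  congr (_ + _ - _); rewrite !big_ord_recl.
  have c0 l : (l < 2)%N -> covar (Y l) (Y N.+3) = 0.
    by case: l => [|[|]]// _; rewrite covar_new_crossings big_ord0.
  rewrite (c0 0%N)// (c0 1%N)// !add0r.
  rewrite (eq_bigr (fun l : 'I_N => 2 * l.+1%:R / 45 - 1 / 90)); last first.
    by move=> [l /= lN] _; rewrite covar_new_crossings_far//; lia.
  elim: {Nn IH X' XE c0} N => [|N IH]; first by rewrite big_ord0; ring.
  by rewrite big_ord_recr /= IH -[N.+1%:R]natr1; field.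
rewrite -[N.+1.+4%:R]natr1 -[N.+4%:R]natr1 -[N.+3%:R]natr1 -[N.+2%:R]natr1 -[N.+1%:R]natr1.
by field.
Qed.

End path_variance.

Lemma path_graph_sym n : symmetric (path_graph n).
Proof. by move=> i j; rewrite /path_graph orbC. Qed.

(** * From the path graph to sums over its edges *)

Section path_sums.
Variable n : nat.

Let succ_sum (F : 'I_n.+1 -> 'I_n.+1 -> nat) :
  (\sum_(a < n.+1) \sum_(b < n.+1) (a.+1 == b) * F a b = \sum_(i < n) F (inord i) (inord i.+1))%N.
Proof.
rewrite big_ord_recr /= [X in (_ + X)%N]big1 ?addn0 => [|b _]; last first.
  by rewrite gtn_eqF// ltn_ord.
apply: eq_bigr => i _.
rewrite (bigD1 (inord i.+1))//= inordK ?ltnS// eqxx mul1n big1 ?addn0.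
  by congr F; apply: val_inj; rewrite /= inordK// ltnS ltnW.
move=> b; rewrite -(inj_eq val_inj) /= inordK ?ltnS// eq_sym => /negPf ->.
by rewrite mul0n.
Qed.

Lemma sum_path_graph (F : 'I_n.+1 -> 'I_n.+1 -> nat) :
  (\sum_(a < n.+1) \sum_(b < n.+1) path_graph n.+1 a b * F a b =
   \sum_(i < n) (F (inord i) (inord i.+1) + F (inord i.+1) (inord i)))%N.
Proof.
rewrite big_split /= -succ_sum -(succ_sum (fun a b => F b a)).
rewrite [X in (_ + X)%N]exchange_big -big_split /=.
apply: eq_bigr => a _; rewrite -big_split /=; apply: eq_bigr => b _.
rewrite -mulnDl /path_graph; congr (_ * _)%N.
by case: eqP => [e|_]; case: eqP => [e'|_] //; lia.
Qed.

Lemma path_graph_degree (u : 'I_n.+1) : (\sum_v path_graph n.+1 u v <= 2)%N.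
Proof.
rewrite (eq_bigr (fun v : 'I_n.+1 => (u.+1 == v :> nat) + (v.+1 == u :> nat))%N).
  rewrite big_split /= -[2%N]/(1 + 1)%N leq_add//.
    have [un|un] := leqP u.+1 n; last first.
      by rewrite big1// => v _; case: eqP => // e; have := ltn_ord v; lia.
    rewrite (bigD1 (inord u.+1))//= big1 ?addn0 ?leq_b1// => v.
    by rewrite -(inj_eq val_inj) /= inordK// eq_sym => /negPf ->.
  case: (posnP u) => u0.
    by rewrite big1// => v _; case: eqP => // e; lia.
  have un := ltn_ord u.
  rewrite (bigD1 (inord u.-1))//= big1 ?addn0 ?leq_b1// => v.
  rewrite -(inj_eq val_inj) /= inordK; last by lia.
  by case: eqP => // e ne; case: eqP => // e'; lia.
move=> v _; rewrite /path_graph.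
by case: eqP => [e|_]; case: eqP => [e'|_] //; lia.
Qed.

End path_sums.

Section path_crossings.
Context {R : realType} {n : nat}.
Implicit Types (s : 'S_n.+1).

Local Notation e := (path_graph n.+1).
Local Notation Y := (@new_crossings R n).

Let edge_alt s (i j : nat) : nat :=
  alternate (place s i) (place s i.+1) (place s j) (place s j.+1).

Let far (i j : nat) := ((i.+1 < j) || (j.+1 < i))%N.

Lemma sum_cross_path s : (\sum_(q | disjoint_edges e q) chords_cross s q =
  4 * \sum_(i < n) \sum_(j < n) far i j * edge_alt s i j)%N.
Proof.
pose H (a b c d : 'I_n.+1) : nat :=
  (uniq [:: a; b; c; d] * alternate (s a) (s b) (s c) (s d))%N.
transitivity (\sum_a \sum_b e a b * \sum_c \sum_d e c d * H a b c d)%N.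
  rewrite big_mkcond /=; symmetry.
  under eq_bigr => a _ do under eq_bigr => b _ do
    (rewrite big_distrr /=; under eq_bigr => c _ do rewrite big_distrr /=).
  rewrite !pair_bigA /=; apply: eq_bigr => -[[[a b] c] d] _ /=.
  by rewrite /H /=; case: (e a b); case: (e c d); case: (_ && _);
     rewrite ?mul1n ?mul0n ?muln0.
rewrite sum_path_graph big_distrr /=; apply: eq_bigr => i _.
rewrite !sum_path_graph -big_split /= big_distrr /=; apply: eq_bigr => j _.
have eqE k l : (k <= n)%N -> (l <= n)%N ->
    ((inord k : 'I_n.+1) == inord l) = (k == l).
  by move=> kn ln; rewrite -(inj_eq val_inj) /= !inordK.
have [iN jN] := (ltn_ord i, ltn_ord j).
have iN' := ltnW iN; have jN' := ltnW jN.
have far_uniq x y z w : perm_eq [:: x; y; z; w] [:: i : nat; i.+1; j : nat; j.+1] ->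
    uniq [:: inord x : 'I_n.+1; inord y; inord z; inord w] = far i j.
  move=> p; have -> : [:: inord x; inord y; inord z; inord w] =
     [seq inord v : 'I_n.+1 | v <- [:: x; y; z; w]] by [].
  rewrite (perm_uniq (perm_map _ p)) /= !inE !eqE//.
  by rewrite /far; lia.
have p1 : perm_eq [:: i : nat; i.+1; j.+1; j : nat] [:: i : nat; i.+1; j : nat; j.+1].
  by apply/seq.permP => Q /=; lia.
have p2 : perm_eq [:: i.+1; i : nat; j : nat; j.+1] [:: i : nat; i.+1; j : nat; j.+1].
  by apply/seq.permP => Q /=; lia.
have p3 : perm_eq [:: i.+1; i : nat; j.+1; j : nat] [:: i : nat; i.+1; j : nat; j.+1].
  by apply/seq.permP => Q /=; lia.
rewrite /H (far_uniq _ _ _ _ (perm_refl _)) (far_uniq _ _ _ _ p1).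
rewrite (far_uniq _ _ _ _ p2) (far_uniq _ _ _ _ p3).
rewrite !(alternate_swapr _ _ (s (inord j))) !(alternate_swapl (s (inord i))).
by rewrite !mulSn mul0n addn0 !addnA.
Qed.

(** Each pair of edges is counted 8 times on both sides: [sum_cross_path] accounts for the 4 choices
    of orientations, and restricting to i + 1 < j for the 2 orders. *)
Lemma crossings_path s : crossings e s = \sum_(j < n) Y j s.
Proof.
have := sum_chords_cross (@path_graph_sym _) s; rewrite sum_cross_path.
have -> : (\sum_(i < n) \sum_(j < n) far i j * edge_alt s i j =
    2 * \sum_(j < n) \sum_(i < n) (i.+1 < j) * edge_alt s i j)%N.
  rewrite mul2n -addnn [X in (X + _)%N]exchange_big -big_split /=.
  apply: eq_bigr => i _; rewrite -big_split /=; apply: eq_bigr => j _.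
  have [ij|ij] := ltnP i.+1 j.
    have -> : (j.+1 < i)%N = false by lia.
    by rewrite /far ij addn0.
  have [ji|ji] := ltnP j.+1 i; last by rewrite /far !ltnNge ij ji.
  rewrite /far ji orbT add0n !mul1n; apply/eqP; rewrite -(eqr_nat R); apply/eqP.
  apply: edge_crossC; have := ltn_ord i; have := ltn_ord j.
  by rewrite /= ?inE; lia.
rewrite mulnA => /eqP; rewrite eqn_pmul2l// => /eqP XE.
rewrite /crossings -XE natr_sum; apply: eq_bigr => j _.
rewrite natr_sum /Y (big_ord_widen n (fun i => edge_cross i j s)); last first.
  by have := ltn_ord j; lia.
rewrite [RHS]big_mkcond; apply: eq_bigr => i _ /=.
rewrite (_ : (i.+1 < j) = (i < j.-1))%N; last by lia.
by case: ifP => _; rewrite ?mul1n ?mul0n.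
Qed.

Theorem var_crossings_path : (3 <= n)%N ->
  covar (crossings e) (crossings e) =
  n.+1%:R ^+ 3 / 45 - n.+1%:R ^+ 2 / 18 - 11 * n.+1%:R / 45 + 2 / 3 :> R.
Proof.
move=> n3; rewrite (eq_covar crossings_path crossings_path).
have := @var_sum_new_crossings R n (n - 3); rewrite /=.
have -> : (n - 3).+3 = n by lia.
by apply.
Qed.

End path_crossings.

(** * The law of the number of crossings *)

Section uniform_expectation.
Context {R : realType} {n : nat} {d : measure_display} {T : measurableType d}.
Context (P : probability T R) (pi : {RV P >-> 'S_n}).
Hypothesis pi_unif : uniform_permutation pi.

Lemma expectation_uniform (g : 'S_n -> R) : expectation P (g \o pi) = (avg g)%:E.
Proof.
rewrite unlock.
have cover : [set: T] = \big[setU/set0]_(s <- enum 'S_n) (pi @^-1` [set s]).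
  apply/seteqP; split => // w _.
  by rewrite -bigcup_seq; exists (pi w) => //=; rewrite mem_enum.
have mpi s : measurable (pi @^-1` [set s]).
  by rewrite -[X in measurable X]setTI; exact: measurable_funP.
rewrite {1}cover integral_bigsetU_EFin//=; last 3 first.
- exact: enum_uniq.
- by move=> s s' _ _ [w [/= <- <-]].
- apply/measurable_EFinP; apply: measurable_funTS.
  by apply: measurableT_comp => //.
rewrite big_enum /= /avg mulr_suml -sumEFin; apply: eq_bigr => s _.
rewrite (eq_integral (fun=> (g s)%:E)) => [|w /[!inE]/= ->//].
rewrite integral_cst// EFinM card_Sn; congr (_ * _)%E.
exact: pi_unif.
Qed.

End uniform_expectation.

Section crossings_law.
Context {R : realType} {n : nat} (e : rel 'I_n).
Context {d : measure_display} {T : measurableType d}.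
Context (P : probability T R) (pi : {RV P >-> 'S_n}).
Hypothesis pi_unif : uniform_permutation pi.

Let X : {RV P >-> R} := crossingsRV e pi.
Let Xc : 'S_n -> R := crossings e.

Lemma expectation_crossings : expectation P X = (avg Xc)%:E.
Proof. exact: (expectation_uniform pi_unif Xc). Qed.

Lemma variance_crossings : 'V_P[X] = (covar Xc Xc)%:E.
Proof.
rewrite /variance unlock expectation_crossings /=.
rewrite (covar_center card_perm_gt0) -(expectation_uniform pi_unif); congr expectation.
Qed.

Lemma cdf_standardize_crossings z : cdf (standardize X) z =
  (avg (fun s => ((Xc s - avg Xc) / Num.sqrt (covar Xc Xc) <= z)%R%:R))%:E.
Proof.
have mA : measurable (standardize X @^-1` `]-oo, z]).
  by rewrite -[X in measurable X]setTI; exact: measurable_funP.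
rewrite /cdf /distribution /pushforward -(expectation_indic P mA).
rewrite -(expectation_uniform pi_unif); congr expectation.
apply/funext => w; rewrite indicE /=; congr (nat_of_bool _)%:R.
have -> : (Xc (pi w) - avg Xc) / Num.sqrt (covar Xc Xc) = standardize X w.
  by rewrite /= /standardize_fun expectation_crossings variance_crossings.
by apply/idP/idP; rewrite inE /= in_itv.
Qed.

End crossings_law.

(** From v >= N^3 / 90 and sqrt(2 N) sqrt(N - 1) <= 3 N / 2 the constant becomes 5 * 1024 * 90 / 192
    * 3 / 2 = 3600, below 6270. The first alternative is sqrt(N - 1) <= 6270; in the second,
    [100 < N] also puts n in the range of the variance formula. *)
Lemma berry_esseen_constant (R : realType) (N : R) : 2 <= N ->
  let v := N ^+ 3 / 45 - N ^+ 2 / 18 - 11 * N / 45 + 2 / 3 in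
  1 <= 6270 / Num.sqrt (N - 1) \/ [/\ 100 < N, 0 < v &
   5 * Num.sqrt (2 * N * (1024 * N ^+ 2) ^+ 2) / (192 * v) <=
   6270 / Num.sqrt (N - 1)].
Proof.
move=> N2 v; set a := Num.sqrt (N - 1).
have N10 : 0 < N - 1 by lra.
have a0 : 0 < a by rewrite sqrtr_gt0.
have aa : a ^+ 2 = N - 1 by rewrite sqr_sqrtr// ltW.
have [a6|a6] := leP a 6270; [left|right].
  by rewrite ler_pdivlMr// mul1r.
have N100 : 100 < N.
  have : 0 < (a - 11) * (a + 11) by apply: mulr_gt0; lra.
  by rewrite (_ : _ * _ = a ^+ 2 - 121); [lra|ring].
have N0 : 0 < N by lra.
have N2_0 : 0 <= N ^+ 2 := sqr_ge0 N.
have N3_0 : 0 < N ^+ 3 := exprn_gt0 3 N0.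
have NN : 0 <= N ^+ 2 - 100 * N.
  by rewrite (_ : _ - _ = N * (N - 100)); [apply: mulr_ge0; lra|ring].
have NNN : 0 <= N ^+ 3 - 100 * N ^+ 2.
  by rewrite (_ : _ - _ = N ^+ 2 * (N - 100)); [apply: mulr_ge0; lra|ring].
have vN : N ^+ 3 / 90 <= v by rewrite /v; lra.
have v0 : 0 < v by lra.
split; [exact: N100|exact: v0|].
set b := Num.sqrt (2 * N).
have bb : b ^+ 2 = 2 * N by rewrite sqr_sqrtr//; lra.
have ab : a * b <= 3 / 2 * N by have := sqr_ge0 (a - b); rewrite sqrrB aa bb; lra.
have M0 : 0 <= 1024 * N ^+ 2 by lra.
have -> : Num.sqrt (2 * N * (1024 * N ^+ 2) ^+ 2) = b * (1024 * N ^+ 2).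
  rewrite sqrtrM; last by lra.
  by rewrite sqrtr_sqr (ger0_norm M0).
have d0 : 0 < 192 * v by lra.
rewrite (ler_pdivrMr _ _ d0) mulrAC (ler_pdivlMr _ _ a0).
have : N ^+ 2 * (a * b) <= N ^+ 2 * (3 / 2 * N) by exact: ler_wpM2l.
have -> : N ^+ 2 * (3 / 2 * N) = 3 / 2 * N ^+ 3 by ring.
lra.
Qed.

Theorem mainTheorem10 (R : realType) (n : nat)
    (d : measure_display) (T : measurableType d) (P : probability T R)
    (pi : {RV P >-> 'S_n}) (pi_unif : uniform_permutation pi)
    (d' : measure_display) (T' : measurableType d') (Q : probability T' R)
    (Z : {RV Q >-> R})
    (Z_normal : forall A : set R, measurable A ->
       distribution Q Z A = normal_prob 0 1 A) :
  let X : {RV P >-> R} := crossingsRV (path_graph n) pi in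
  let W : {RV P >-> R} := standardize X in
  ((4 <= n)%N ->
     'V_P[X] = (n%:R ^+ 3 / 45 - n%:R ^+ 2 / 18 - 11 * n%:R / 45 + 2 / 3)%:E) /\
  ((2 <= n)%N ->
     (kolmogorov_distance W Z <= (6270 / Num.sqrt (n%:R - 1))%:E)%E).
Proof.
case: n pi pi_unif => [|n] pi pi_unif //=.
split => [n4|n2].
  by rewrite variance_crossings// var_crossings_path.
apply: ge_ereal_sup => _ [z _ <-].
have cdfZ : cdf Z z = (ncdf z)%:E.
  by rewrite /cdf Z_normal// /ncdf fineK// -Z_normal// fin_num_measure.
have := cdf_ge0 (standardize (crossingsRV (path_graph n.+1) pi)) z.
have := cdf_le1 (standardize (crossingsRV (path_graph n.+1) pi)) z.
have := ncdf_ge0 z; have := ncdf_le1 z.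
rewrite cdfZ cdf_standardize_crossings// -EFinB abse_EFin !lee_fin => p1 p0 q1 q0.
have [|big|[N100 v0 bound]] := @berry_esseen_constant R n.+1%:R.
- by rewrite ler_nat.
(* Two probabilities differ by at most 1. This covers n = 2 and n = 3, where the variance is 0 and
   [standardize] is constant. *)
- by apply: le_trans big; rewrite ler_norml; lra.
have n3 : (3 <= n)%N by move: N100; rewrite ltr_nat; lia.
apply: le_trans bound.
rewrite -(var_crossings_path n3) in v0 *.
apply: kolmogorov_crossings => //; first exact: path_graph_sym.
exact: path_graph_degree.
Qed.
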